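(* Let $L>0$, $p>0$, $\lambda,\kappa,\gamma>0$, $\alpha,\beta\in\mathbb{R}$, $\mu\in\mathbb{R}\setminus\{0\}$, and let $N$ be a positive integer such that $$\frac{1}{N^2}<\min\left\{1-\frac{4\gamma}{\mu},\ \frac{4\lambda}{\mu L^2}\right\}.$$ Let $u=u(x,t)$ be a sufficiently smooth complex-valued solution of $$u_t-(\lambda+i\alpha)u_{xx}+(\kappa+i\beta)|u|^p u-\gamma u=-\mu\sum_{k=1}^{N}\overline{u}_k\,\chi_{J_k}(x),\quad x\in(0,L),\ t>0,$$ $$u_x(0,t)=u_x(L,t)=0,\quad t>0,\qquad u(x,0)=u_0(x),\quad x\in(0,L).$$ Then for all $t\ge 0$, $$\|u(t)\|_{L^2(0,L)}^2\le e^{-\mu\left(\frac12-\frac{2\gamma}{\mu}-\frac{1}{2N^2}\right)t}\,\|u_0\|_{L^2(0,L)}^2 .$$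
   Context: For $k=1,\dots,N$: $J_k=\left[\frac{(k-1)L}{N},\frac{kL}{N}\right)$, $\chi_{J_k}$ is the characteristic function of $J_k$, and $\overline{u}_k=\overline{u}_k(t)=\frac{1}{|J_k|}\int_{J_k}u(x,t)\,dx$ is the local average of $u$ over $J_k$ (here the bar does not denote complex conjugation). The existence of the solution is assumed. ''Sufficiently smooth'' means regular enough in time and space that one may multiply the equation by the complex conjugate of $u$, integrate over $(0,L)$, integrate by parts and differentiate $\|u(t)\|_{L^2}^2$ in time; for definiteness one may take $u\in C([0,\infty);H^2(0,L))\cap C^1([0,\infty);L^2(0,L))$. *)

(* Defs.v *)
From HB Require Import structures.
From mathcomp Require Import all_boot all_order all_algebra.
From mathcomp Require Import all_classical all_reals all_analysis.
From mathcomp.real_closed Require Export complex.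

Set Implicit Arguments.
Unset Strict Implicit.
Unset Printing Implicit Defensive.

Import Order.TTheory GRing.Theory Num.Theory.
Import numFieldNormedType.Exports.

Local Open Scope classical_set_scope.
Local Open Scope ring_scope.
Local Open Scope complex_scope.

(* The modulus as an element of R; the ring norm of R[i] takes values in R[i]. *)
Definition cabs (R : realType) (z : R[i]) : R := complex.Re `|z|.

Definition cintegral (R : realType) (A : set R) (f : R -> R[i]) : R[i] :=
  (\int[lebesgue_measure]_(x in A) complex.Re (f x))
    +i* (\int[lebesgue_measure]_(x in A) complex.Im (f x)).

(* Elements of L^2(0, L) and of H^2(0, L) are given by representatives defined
   on R; only their values almost everywhere on (0, L) matter. *)
Definition L2 (R : realType) (L : R) (f : R -> R[i]) : Prop :=
  [/\ measurable_fun `]0, L[ (fun x => complex.Re (f x)),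
      measurable_fun `]0, L[ (fun x => complex.Im (f x)) &
      lebesgue_measure.-integrable `]0, L[ (fun x => (cabs (f x) ^+ 2)%:E)].

Definition L2norm (R : realType) (L : R) (f : R -> R[i]) : R :=
  Num.sqrt (\int[lebesgue_measure]_(x in `]0, L[) (cabs (f x) ^+ 2)).

(* The test functions C^1_c(0, L).  Real-valued ones suffice, by linearity. *)
Definition test_function (R : realType) (L : R) (phi : R -> R) : Prop :=
  [/\ forall x : R, derivable phi x 1,
      continuous (derive1 phi) &
      exists a b : R,
        [/\ 0 < a, b < L & forall x, phi x != 0 -> a <= x <= b]].

(* g is the weak derivative of f, both being in L^2(0, L): equivalently, f is in
   H^1(0, L) and f' = g. *)
Definition weak_derivative (R : realType) (L : R) (f g : R -> R[i]) : Prop :=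
  [/\ L2 L f, L2 L g &
      forall phi : R -> R, test_function L phi ->
        cintegral `]0, L[ (fun x => f x * (derive1 phi x)%:C)
        = - cintegral `]0, L[ (fun x => g x * (phi x)%:C)].

Definition H2norm (R : realType) (L : R) (f f1 f2 : R -> R[i]) : R :=
  Num.sqrt (L2norm L f ^+ 2 + L2norm L f1 ^+ 2 + L2norm L f2 ^+ 2).

(* u in C([0, oo); H^2(0, L)), with first and second weak space derivatives ux
   and uxx.  Functions of space and time take the time variable first. *)
Definition C_H2 (R : realType) (L : R) (u ux uxx : R -> R -> R[i]) : Prop :=
  (forall t, 0 <= t ->
     weak_derivative L (u t) (ux t) /\ weak_derivative L (ux t) (uxx t)) /\
  (forall t, 0 <= t ->
     H2norm L (fun x => u s x - u t x) (fun x => ux s x - ux t x)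
       (fun x => uxx s x - uxx t x) @[s --> within `[0, +oo[ (nbhs t)]
       --> (0 : R)).

(* u in C^1([0, oo); L^2(0, L)) with time derivative ut; at t = 0 both the
   derivative and the continuity are one-sided. *)
Definition C1_L2 (R : realType) (L : R) (u ut : R -> R -> R[i]) : Prop :=
  [/\ forall t, 0 <= t -> L2 L (u t) /\ L2 L (ut t),
      forall t, 0 <= t ->
        L2norm L (fun x => ((s - t)^-1)%:C * (u s x - u t x) - ut t x)
          @[s --> within `[0, +oo[ (dnbhs t)] --> (0 : R) &
      forall t, 0 <= t ->
        L2norm L (fun x => ut s x - ut t x)
          @[s --> within `[0, +oo[ (nbhs t)] --> (0 : R)].

(* The boundary values of g in H^1(0, L) are those of its representative which
   is continuous on [0, L]. *)
Definition boundary_values (R : realType) (L : R) (g : R -> R[i])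
    (a b : R[i]) : Prop :=
  exists c : R -> R[i],
    [/\ {within `[0, L], continuous (fun x => complex.Re (c x))},
        {within `[0, L], continuous (fun x => complex.Im (c x))},
        {ae lebesgue_measure, forall x, x \in `]0, L[ -> g x = c x},
        c 0 = a & c L = b].

Definition J (R : realType) (L : R) (N k : nat) : set R :=
  `[(k%:R - 1) * L / N%:R, k%:R * L / N%:R[.

Definition average (R : realType) (A : set R) (f : R -> R[i]) : R[i] :=
  ((fine (lebesgue_measure A))^-1)%:C * cintegral A f.

(* Main.v *)
Require Import Defs.
From HB Require Import structures.
From mathcomp Require Import all_boot all_order all_algebra.
From mathcomp Require Import all_classical all_reals all_analysis.
From mathcomp Require Import measurable_realfun.
From mathcomp Require Import ring lra.
Import Order.TTheory GRing.Theory Num.Theory.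
Import numFieldNormedType.Exports.
Local Open Scope classical_set_scope.
Local Open Scope ring_scope.
Local Open Scope complex_scope.

(** Multiply the equation by the conjugate of u, integrate over ]0, L[ and take
    real parts.  Writing y = ||u||^2, h = L / N, and m_k for the average of u
    over J_k, the sign of kappa and the Neumann condition give
      y' / 2 <= gamma y - lambda ||u_x||^2 - mu sum_k h |m_k|^2.
    The Poincare inequality on a cell,
      ||u||_(J_k)^2 <= h |m_k|^2 + h^2 ||u_x||_(J_k)^2,
    shows that mean and gradient together control u.  The hypothesis
    1 / N^2 < 4 lambda / (mu L^2) forces mu > 0 and says that
    mu h^2 / 4 < lambda, so that
      lambda ||u_x||^2 + mu sum_k h |m_k|^2 >= (mu / 4) ||u||^2
    (cell_coercivity).  Hence y' <= 2 (gamma - mu / 4) y (energy_inequality), and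
    gronwall gives y(t) <= exp (- (mu / 2 - 2 gamma) t) y(0), which implies the
    claim.

    The remaining work is to justify these computations for functions which are
    regular in the Sobolev sense only.  Everything reduces to
    weak_derivative_primitive: a function with an integrable weak derivative g is
    almost everywhere a constant plus the primitive of g.  It is proved by testing
    against smoothed steps which concentrate at Lebesgue points.  Primitives
    satisfy an integration by parts formula which is an instance of Fubini's
    theorem (primitive_by_parts); the continuous representative of u_x fixes the
    constant in u_x = k + primitive u_xx, and its zero boundary values make the
    boundary terms vanish (neumann_primitive, primitive_integration_by_parts).
    Differentiability of y in time follows by expanding the square of the norm
    (energy_derivative, L2norm_sqr_derivative). *)

Set Implicit Arguments.
Unset Strict Implicit.
Unset Printing Implicit Defensive.

(** * Integrable and square-integrable real functions *)

Section integrable_functions.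
Context d (T : measurableType d) (R : realType).
Variable mu : {measure set T -> \bar R}.
Variable D : set T.
Hypothesis mD : measurable D.
Implicit Types f g : T -> R.

Lemma RintegrableD f g :
  mu.-integrable D (EFin \o f) -> mu.-integrable D (EFin \o g) ->
  mu.-integrable D (EFin \o (fun x => f x + g x)).
Proof. by move=> intf intg; exact: (integrableD mD intf intg). Qed.

Lemma RintegrableN f : mu.-integrable D (EFin \o f) ->
  mu.-integrable D (EFin \o (fun x => - f x)).
Proof. by move=> intf; exact: (integrableN intf). Qed.

Lemma RintegrableB f g :
  mu.-integrable D (EFin \o f) -> mu.-integrable D (EFin \o g) ->
  mu.-integrable D (EFin \o (fun x => f x - g x)).
Proof. by move=> intf intg; exact: RintegrableD intf (RintegrableN intg). Qed.

Lemma RintegrableZ k f : mu.-integrable D (EFin \o f) ->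
  mu.-integrable D (EFin \o (fun x => k * f x)).
Proof. by move=> intf; exact: (integrableZl mD k intf). Qed.

Lemma Rintegrable_cst (k : R) :
  (mu D < +oo)%E -> mu.-integrable D (EFin \o cst k).
Proof.
move=> Dfin; apply: measurable_bounded_integrable => //.
exists `|k|; split; first exact: num_real.
by move=> M kM x _ /=; exact: ltW.
Qed.

Lemma Rintegrable_measurable f :
  mu.-integrable D (EFin \o f) -> measurable_fun D f.
Proof. by move=> intf; exact/measurable_EFinP/(measurable_int mu). Qed.

Lemma Rintegrable_le f g :
  measurable_fun D f -> (forall x, D x -> `|f x| <= g x) ->
  mu.-integrable D (EFin \o g) -> mu.-integrable D (EFin \o f).
Proof.
move=> mf fg; apply: le_integrable => //; first exact/measurable_EFinP.
by move=> x Dx; rewrite /= lee_fin (le_trans (fg x Dx)) ?ler_norm.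
Qed.

Lemma ae_eq_Rintegral f g :
  mu.-integrable D (EFin \o f) -> mu.-integrable D (EFin \o g) ->
  {ae mu, forall x, D x -> f x = g x} ->
  \int[mu]_(x in D) f x = \int[mu]_(x in D) g x.
Proof.
move=> intf intg fg; rewrite /Rintegral; congr fine.
apply: ae_eq_integral => //; [exact: (measurable_int mu)..|].
by apply: filterS fg => x fgx Dx /=; rewrite fgx.
Qed.

Lemma ae_le_Rintegral f g :
  mu.-integrable D (EFin \o f) -> mu.-integrable D (EFin \o g) ->
  {ae mu, forall x, D x -> f x <= g x} ->
  \int[mu]_(x in D) f x <= \int[mu]_(x in D) g x.
Proof.
move=> intf intg fg; rewrite -subr_ge0 -RintegralB//.
have intn := integrable_norm (RintegrableB intg intf).
rewrite (@ae_eq_Rintegral _ (fun x => `|g x - f x|)) //; last 2 first.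
- exact: RintegrableB.
- by apply: filterS fg => x fgx Dx; rewrite ger0_norm// subr_ge0 fgx.
by apply: Rintegral_ge0 => x _.
Qed.

End integrable_functions.

Definition sqintegrable d (T : measurableType d) (R : realType)
    (mu : {measure set T -> \bar R}) (D : set T) (f : T -> R) : Prop :=
  measurable_fun D f /\ mu.-integrable D (EFin \o (fun x => f x ^+ 2)).

Section square_integrable_functions.
Context d (T : measurableType d) (R : realType).
Variable mu : {measure set T -> \bar R}.
Variable D : set T.
Hypothesis mD : measurable D.
Implicit Types f g : T -> R.

Lemma sqintegrable_mul f g : sqintegrable mu D f -> sqintegrable mu D g ->
  mu.-integrable D (EFin \o (fun x => f x * g x)).
Proof.
move=> [mf f2] [mg g2].
apply: (Rintegrable_le mD _ _ (RintegrableD mD f2 g2)).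
  exact: measurable_funM.
move=> x _; rewrite ler_norml; apply/andP; split; nra.
Qed.

Lemma sqintegrable_Rintegrable f :
  (mu D < +oo)%E -> sqintegrable mu D f -> mu.-integrable D (EFin \o f).
Proof.
move=> Dfin [mf f2].
have int1 := RintegrableD mD f2 (Rintegrable_cst mD 1 Dfin).
apply: (Rintegrable_le mD _ _ int1) => // x _.
rewrite /= ler_norml; apply/andP; split; nra.
Qed.

Lemma sqintegrableD f g : sqintegrable mu D f -> sqintegrable mu D g ->
  sqintegrable mu D (fun x => f x + g x).
Proof.
move=> hf hg; have fg := sqintegrable_mul hf hg; case: hf hg => [mf f2] [mg g2].
split; first exact: measurable_funD.
have := RintegrableD mD (RintegrableD mD f2 g2) (RintegrableZ mD 2 fg).
by apply: eq_integrable mD _ _ _ => x _ /=; congr EFin; ring.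
Qed.

Lemma sqintegrableZ k f :
  sqintegrable mu D f -> sqintegrable mu D (fun x => k * f x).
Proof.
move=> [mf f2]; split; first exact: measurable_funM.
have := RintegrableZ mD (k ^+ 2) f2.
by apply: eq_integrable mD _ _ _ => x _ /=; congr EFin; ring.
Qed.

Lemma sqintegrableB f g : sqintegrable mu D f -> sqintegrable mu D g ->
  sqintegrable mu D (fun x => f x - g x).
Proof.
move=> hf /(sqintegrableZ (-1)) hg; have [m2 i2] := sqintegrableD hf hg.
have E : (fun x => f x - g x) = (fun x => f x + -1 * g x).
  by apply/funext => x; rewrite mulN1r.
by rewrite E.
Qed.

Lemma Rintegral_sqrD f g : sqintegrable mu D f -> sqintegrable mu D g ->
  \int[mu]_(x in D) (f x + g x) ^+ 2 = \int[mu]_(x in D) (f x) ^+ 2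
    + 2 * \int[mu]_(x in D) (f x * g x) + \int[mu]_(x in D) (g x) ^+ 2.
Proof.
move=> hf hg; have fg := sqintegrable_mul hf hg.
under eq_Rintegral do rewrite sqrrD -mulr_natl.
rewrite RintegralD//; last exact: hg.2; last first.
  exact: RintegrableD hf.2 (RintegrableZ mD 2 fg).
rewrite RintegralD//; [|exact: hf.2|exact: RintegrableZ].
by rewrite RintegralZl.
Qed.

(** Discriminant of the nonnegative quadratic s |-> \int (f + s g)^2. *)
Lemma Cauchy_Schwarz_Rintegral f g : sqintegrable mu D f -> sqintegrable mu D g ->
  (\int[mu]_(x in D) (f x * g x)) ^+ 2
  <= \int[mu]_(x in D) f x ^+ 2 * \int[mu]_(x in D) g x ^+ 2.
Proof.
move=> hf hg; set A := Rintegral _ _ (fun x => f x ^+ 2).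
set B := Rintegral _ _ (fun x => f x * g x).
set C := Rintegral _ _ (fun x => g x ^+ 2).
have A0 : 0 <= A by apply: Rintegral_ge0 => x _; exact: sqr_ge0.
have C0 : 0 <= C by apply: Rintegral_ge0 => x _; exact: sqr_ge0.
have pos s : 0 <= A + 2 * (s * B) + s ^+ 2 * C.
  have -> : A + 2 * (s * B) + s ^+ 2 * C =
      \int[mu]_(x in D) (f x + s * g x) ^+ 2.
    rewrite Rintegral_sqrD//; last exact: sqintegrableZ.
    congr (_ + 2 * _ + _).
      rewrite -RintegralZl//; last exact: sqintegrable_mul.
      by apply: eq_Rintegral => x _; ring.
    rewrite -RintegralZl//; last exact: hg.2.
    by apply: eq_Rintegral => x _; ring.
  by apply: Rintegral_ge0 => x _; exact: sqr_ge0.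
have [C00|C00] := eqVneq C 0.
  (* The polynomial is then affine in s; were B nonzero, it would take the value
     -1 at the point chosen below. *)
  have [->|B0] := eqVneq B 0; first by rewrite expr0n/= mulr_ge0.
  have := pos (- (A + 1) / (2 * B)).
  have -> : A + 2 * (- (A + 1) / (2 * B) * B) + (- (A + 1) / (2 * B)) ^+ 2 * C
      = - 1.
    by rewrite C00; field.
  by rewrite oppr_ge0 ler10.
have := pos (- B / C).
have -> : A + 2 * (- B / C * B) + (- B / C) ^+ 2 * C = (A * C - B ^+ 2) / C.
  by field.
by rewrite pmulr_lge0 ?invr_gt0 ?lt_def ?C00// subr_ge0.
Qed.

End square_integrable_functions.

Section restriction.
Context d (T : measurableType d) (R : realType).
Variable mu : {measure set T -> \bar R}.
Implicit Types (f g : T -> R) (D B : set T).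

Lemma Rintegral_support D B f :
  B `<=` D -> (forall x, D x -> ~ B x -> f x = 0) ->
  \int[mu]_(x in D) f x = \int[mu]_(x in B) f x.
Proof.
move=> BD f0; rewrite Rintegral_mkcond [RHS]Rintegral_mkcond; congr Rintegral.
apply/funext => x; rewrite !patchE.
case: ifPn => [|xD]; rewrite ?inE ?notin_setE.
  by case: ifPn => //; rewrite notin_setE => nB xD; rewrite f0.
by case: ifPn => // /set_mem /BD /mem_set; rewrite (negbTE xD).
Qed.

Lemma Rintegrable_restrict D f : measurable D -> mu.-integrable D (EFin \o f) ->
  mu.-integrable setT (EFin \o (f \_ D)).
Proof.
by move=> mD intf; rewrite -restrict_EFin; exact: (integrable_mkcond _ mD).1.
Qed.

Lemma Rintegral_patch D B f : B `<=` D ->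
  \int[mu]_(x in B) (f \_ D) x = \int[mu]_(x in B) f x.
Proof.
by move=> BD; apply: eq_Rintegral => x /set_mem/BD Dx; rewrite patchE mem_set.
Qed.

Lemma Rintegrable_bounded B f (h : T -> R) :
  measurable B -> measurable_fun setT h -> [bounded h x : R^o | x in B] ->
  mu.-integrable B (EFin \o f) ->
  mu.-integrable B (EFin \o (fun x => f x * h x)).
Proof.
move=> mB mh bh intf.
by apply: (integrableMl mB intf _ bh); exact: measurable_funTS.
Qed.

End restriction.

(** * Smoothed steps as test functions *)

Section smoothed_step.
Context (R : realType).
Implicit Types x y a e : R.

(** tent, the second difference of the positive part, is the hat function on
    [-1, 1]; step, the second difference of a primitive of the positive part,
    is a primitive of it which rises from 0 to 1 and is of class C^1. *)
Definition ramp y : R := Num.max y 0.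
Definition sqramp y : R := ramp y ^+ 2 / 2.
Definition tent y : R := ramp (y + 1) - 2 * ramp y + ramp (y - 1).
Definition step y : R := sqramp (y + 1) - 2 * sqramp y + sqramp (y - 1).

Lemma rampP y : y <= 0 /\ ramp y = 0 \/ 0 <= y /\ ramp y = y.
Proof.
rewrite /ramp; case: (leP y 0) => y0; first by left; split.
by right; split => //; exact: ltW.
Qed.

Lemma continuous_ramp : continuous ramp.
Proof. by move=> y; apply: continuous_max; [exact: cvg_id|exact: cvg_cst]. Qed.

Lemma is_derive_sqramp y : is_derive y (1 : R) sqramp (ramp y).
Proof.
(* The remainder is quadratic on both sides of the kink and across it. *)
have bnd h : `|sqramp (h + y) - sqramp y - h * ramp y| <= h ^+ 2.
  rewrite /sqramp; have [[? ->]|[? ->]] := rampP (h + y);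
  have [[? ->]|[? ->]] := rampP y; rewrite ler_norml; apply/andP; split; nra.
have H : h^-1 *: ((sqramp \o shift y) (h *: (1 : R)) - sqramp y) @[h --> 0^'] -->
    ramp y.
  apply/cvgrPdist_le => e e0; near=> h.
  have h0 : h != 0 by near: h; exact: nbhs_dnbhs_neq.
  rewrite /= distrC [_ *: 1]mulr1 -[_ *: _]/(_ * _).
  have -> : h^-1 * (sqramp (h + y) - sqramp y) - ramp y
      = h^-1 * (sqramp (h + y) - sqramp y - h * ramp y) by field.
  rewrite normrM normfV ler_pdivrMl ?normr_gt0//.
  apply: (le_trans (bnd h)); rewrite -real_normK ?num_real// expr2.
  rewrite ler_wpM2l//; near: h; apply: dnbhs0_le => //.
apply: DeriveDef; last exact: cvg_lim.
by apply/cvg_ex; exists (ramp y).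
Unshelve. all: by end_near. Qed.

Lemma is_derive_step a e x :
  is_derive x (1 : R) (fun z => step ((z - a) / e)) (e^-1 * tent ((x - a) / e)).
Proof.
pose l c (z : R) : R := (z - a) / e + c.
have dl c : is_derive x (1 : R) (l c) e^-1.
  apply/is_derive1_caratheodory; exists (fun=> e^-1); split => //.
    by move=> z; rewrite /l; ring.
  exact: cvg_cst.
have dq c : is_derive x (1 : R) (sqramp \o l c) (e^-1 * ramp (l c x)).
  apply: (is_derive_eq (is_derive1_comp (is_derive_sqramp _) (dl c))).
  by rewrite mulrC.
have -> : (fun z => step ((z - a) / e)) =
  (sqramp \o l 1) - (2 : R) \*: (sqramp \o l 0) + (sqramp \o l (-1)).
  apply/funext => z; rewrite -[RHS]/(sqramp (l 1 z) - 2 * sqramp (l 0 z)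
    + sqramp (l (-1) z)).
  by rewrite /step /l addr0.
apply: is_derive_eq.
by rewrite /tent /l addr0 /GRing.scale/=; ring.
Qed.

Lemma continuous_tent : continuous tent.
Proof.
have c k : continuous (fun y => ramp (y + k)).
  by move=> y; apply: (@continuous_comp _ _ _ (fun y => y + k) ramp);
    [apply: cvgD; [exact: cvg_id|exact: cvg_cst]|exact: continuous_ramp].
move=> y; apply: cvgD; last exact: c.
apply: cvgB; first exact: c.
by apply: cvgM; [exact: cvg_cst|exact: continuous_ramp].
Qed.

Lemma tent_bounds y : 0 <= tent y <= 1.
Proof.
rewrite /tent; have [[? ->]|[? ->]] := rampP (y + 1);
have [[? ->]|[? ->]] := rampP (y - 1);
have [[? ->]|[? ->]] := rampP y; apply/andP; split; lra.
Qed.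

Lemma tent_eq0 y : 1 <= `|y| -> tent y = 0.
Proof.
rewrite ler_normr => /orP y1.
rewrite /tent; have [[? ->]|[? ->]] := rampP (y + 1);
have [[? ->]|[? ->]] := rampP (y - 1);
have [[? ->]|[? ->]] := rampP y; case: y1 => ?; lra.
Qed.

Lemma step_bounds y : 0 <= step y <= 1.
Proof.
rewrite /step /sqramp; have [[? ->]|[? ->]] := rampP (y + 1);
have [[? ->]|[? ->]] := rampP (y - 1);
have [[? ->]|[? ->]] := rampP y; apply/andP; split; nra.
Qed.

Lemma step_eq0 y : y <= -1 -> step y = 0.
Proof.
move=> y1; rewrite /step /sqramp; have [[? ->]|[? ->]] := rampP (y + 1);
have [[? ->]|[? ->]] := rampP (y - 1);
have [[? ->]|[? ->]] := rampP y; nra.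
Qed.

Lemma step_eq1 y : 1 <= y -> step y = 1.
Proof.
move=> y1; rewrite /step /sqramp; have [[? ->]|[? ->]] := rampP (y + 1);
have [[? ->]|[? ->]] := rampP (y - 1);
have [[? ->]|[? ->]] := rampP y; nra.
Qed.

End smoothed_step.

(** * Weakly differentiable functions are primitives *)

Section weak_derivative.
Context (R : realType).
Variable L : R.
Notation mu := (@lebesgue_measure R).
Notation D := (`]0, L[%classic : set R).
Implicit Types (f g : R -> R) (a b e x : R).

Lemma near0_ball a : D a -> \forall e \near 0^'+, 0 < a - e /\ a + e < L.
Proof.
rewrite /= in_itv/= => /andP[a0 aL]; near=> e; split.
  by rewrite subr_gt0; near: e; exact: nbhs_right_lt.
by rewrite addrC -ltrBrDr; near: e; apply: nbhs_right_lt; rewrite subr_gt0.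
Unshelve. all: by end_near. Qed.

Lemma continuous_steps a e : continuous (fun z : R => step ((z - a) / e)).
Proof.
move=> x; have := @ex_derive _ _ _ _ _ _ _ (is_derive_step a e x).
by move=> /derivable1_diffP dx; exact: differentiable_continuous.
Qed.

Lemma measurable_step e a : measurable_fun setT (fun x => step ((x - a) / e)).
Proof. by apply: continuous_measurable_fun => x; exact: continuous_steps. Qed.

Lemma continuous_tents a e : continuous (fun x => e^-1 * tent ((x - a) / e)).
Proof.
move=> x; apply: cvgM; first exact: cvg_cst.
apply: (@continuous_comp _ _ _ (fun x => (x - a) / e) (@tent R)).
  2: exact: continuous_tent.
by apply: cvgM; [apply: cvgB; [exact: cvg_id|exact: cvg_cst]|exact: cvg_cst].
Qed.

Lemma measurable_tent a e :
  measurable_fun setT (fun x => e^-1 * tent ((x - a) / e)).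
Proof. by apply: continuous_measurable_fun => x; exact: continuous_tents. Qed.

Lemma test_function_steps a b e : 0 < e -> 0 < a - e -> a + e < L ->
  0 < b - e -> b + e < L ->
  test_function L (fun x => step ((x - a) / e) - step ((x - b) / e)).
Proof.
move=> e0 a0 aL b0 bL.
have dphi x : is_derive x (1 : R)
    (fun x => step ((x - a) / e) - step ((x - b) / e))
    (e^-1 * tent ((x - a) / e) - e^-1 * tent ((x - b) / e)).
  exact: is_deriveB (is_derive_step a e x) (is_derive_step b e x).
split.
- by move=> x; exact: (@ex_derive _ _ _ _ _ _ _ (dphi x)).
- rewrite (_ : derive1 _ =
     (fun x => e^-1 * tent ((x - a) / e) - e^-1 * tent ((x - b) / e))).
    by move=> x; apply: cvgB; exact: continuous_tents.
  by apply/funext => x; rewrite derive1E (@derive_val _ _ _ _ _ _ _ (dphi x)).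
- exists (Num.min (a - e) (b - e)), (Num.max (a + e) (b + e)).
  rewrite lt_min a0 b0 gt_max aL bL; split => // x; apply: contraNT.
  rewrite negb_and -!ltNge lt_min gt_max => /orP[|] /andP[xa xb].
    by rewrite !step_eq0 ?subrr// ler_pdivrMr// mulN1r; lra.
  by rewrite !step_eq1 ?subrr// ler_pdivlMr// mul1r; lra.
Qed.

Lemma derive1_steps a b e x :
  derive1 (fun x => step ((x - a) / e) - step ((x - b) / e)) x
  = e^-1 * tent ((x - a) / e) - e^-1 * tent ((x - b) / e).
Proof.
have dphi := is_deriveB (is_derive_step a e x) (is_derive_step b e x).
by rewrite derive1E (@derive_val _ _ _ _ _ _ _ dphi).
Qed.

Lemma integral_tent a e : 0 < e ->
  \int[mu]_(x in ball a e) (e^-1 * tent ((x - a) / e)) = 1.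
Proof.
move=> e0; have ab : a - e < a + e by lra.
rewrite ball_itv /Rintegral.
rewrite -(@integral_itv_bndoo _ _ _ _ true false); last first.
  by apply/measurable_EFinP; apply: measurable_funTS; exact: measurable_tent.
rewrite (@continuous_FTC2 _ _ (fun z => step ((z - a) / e)))//.
- have -> : (a + e - a) / e = 1 by field; lra.
  have -> : (a - e - a) / e = -1 by field; lra.
  by rewrite step_eq1// step_eq0//= subr0.
- by apply: continuous_subspaceT => x; exact: continuous_tents.
- split.
  + move=> x _; exact: (@ex_derive _ _ _ _ _ _ _ (is_derive_step a e x)).
  + by apply: cvg_at_right_filter; exact: continuous_steps.
  + by apply: cvg_at_left_filter; exact: continuous_steps.
- move=> x _; rewrite derive1E.
  by rewrite (@derive_val _ _ _ _ _ _ _ (is_derive_step a e x)).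
Qed.

Lemma tent_bounded e a (B : set R) : 0 < e ->
  [bounded (e^-1 * tent ((x - a) / e) : R^o) | x in B].
Proof.
move=> e0; exists e^-1; split => [|M eM]; first exact: num_real.
move=> x _ /=.
have /andP[t0 t1] := tent_bounds ((x - a) / e).
rewrite normrM ger0_norm ?invr_ge0 ?(ltW e0)// ger0_norm//.
by apply: le_trans (ltW eM); rewrite ler_piMr// invr_ge0 ltW.
Qed.

Lemma step_bounded e a (B : set R) :
  [bounded (step ((x - a) / e) : R^o) | x in B].
Proof.
exists 1; split => // M M1 x _ /=.
have /andP[t0 t1] := step_bounds ((x - a) / e).
by rewrite ger0_norm//; apply: le_trans t1 (ltW M1).
Qed.

(** The kernel has integral 1 and is at most 1 / e on a ball of measure 2 e, so
    the error is at most twice the mean deviation of f from f a on that ball,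
    which tends to 0 at a Lebesgue point. *)
Lemma cvg_tent_average f a : mu.-integrable D (EFin \o f) -> D a ->
  lebesgue_pt (f \_ D) a ->
  \int[mu]_(x in D) (f x * (e^-1 * tent ((x - a) / e))) @[e --> 0^'+] --> f a.
Proof.
move=> intf Da /fine_cvgP[fin0 lim0].
have Ff x : D x -> (f \_ D) x = f x by move=> Dx; rewrite patchE mem_set.
apply/cvgrPdist_le => eps eps0; near=> e.
have e0 : 0 < e by [].
have [ae aeL] : 0 < a - e /\ a + e < L by near: e; exact: near0_ball.
have BD : ball a e `<=` D.
  by rewrite ball_itv => x /=; rewrite !in_itv/= => /andP[? ?]; lra.
have mB : measurable (ball a e : set (measurableTypeR R)) by exact: measurable_ball.
have muB : mu (ball a e : set R) = (e *+ 2)%:E.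
  by rewrite lebesgue_measure_ball// ltW.
have intB : mu.-integrable (ball a e : set R) (EFin \o f).
  by apply: integrableS intf => //; exact: measurable_itv.
have intc : mu.-integrable (ball a e : set R) (EFin \o cst (f a)).
  by apply: Rintegrable_cst => //=; rewrite [X in (X < _)%E]muB ltry.
rewrite (@Rintegral_support _ _ _ mu D (ball a e))//; last first.
  move=> x _; rewrite -ball_normE /= => /negP; rewrite -leNgt => ex.
  rewrite tent_eq0 ?mulr0// normrM normfV (gtr0_norm e0).
  by rewrite ler_pdivlMr// mul1r distrC.
have intK h : mu.-integrable (ball a e : set R) (EFin \o h) ->
    mu.-integrable (ball a e : set R)
      (EFin \o (fun x => h x * (e^-1 * tent ((x - a) / e)))).
  move=> ih; apply: (@Rintegrable_bounded _ _ _ mu) ih => //.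
    exact: measurable_tent.
  exact: tent_bounded.
have -> : f a = \int[mu]_(x in ball a e) (f a * (e^-1 * tent ((x - a) / e))).
  rewrite RintegralZl// ?integral_tent ?mulr1//.
  have int1 : mu.-integrable (ball a e : set R) (EFin \o cst 1).
    by apply: Rintegrable_cst => //=; rewrite [X in (X < _)%E]muB ltry.
  apply: eq_integrable (intK _ int1) => // x _.
  by rewrite /= mul1r.
rewrite -RintegralB//; [|exact: intK|exact: intK].
apply: le_trans (le_normr_Rintegral _ _) _ => //.
  by apply: RintegrableB => //; exact: intK.
have intn := integrable_norm (RintegrableB mB intB intc).
apply: (@le_trans _ _ (\int[mu]_(x in ball a e) (e^-1 * `|f x - f a|))).
  apply: le_Rintegral => //.
  - by apply: integrable_norm; apply: RintegrableB => //; exact: intK.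
  - exact: RintegrableZ.
  - move=> x _; rewrite -mulrBl normrM mulrC distrC ler_wpM2r//.
    have /andP[t0 t1] := tent_bounds ((x - a) / e).
    rewrite normrM ger0_norm ?invr_ge0 ?(ltW e0)// ger0_norm//.
    by rewrite ler_piMr// invr_ge0 ltW.
rewrite RintegralZl//.
have -> : \int[mu]_(x in ball a e) `|f x - f a| =
    2 * e * fine (davg (f \_ D) a e).
  rewrite /davg /iavg muB inver.
  rewrite (_ : (\int[mu]_(y in ball a e) _)%E =
    (\int[mu]_(x in ball a e) `|f x - f a|)%:E); last first.
    rewrite /Rintegral fineK; last exact: integrable_fin_num intn.
    apply: eq_integral => x /set_mem Bx.
    by rewrite /= !Ff //; exact: BD.
  rewrite mulrn_eq0/= gt_eqF// -EFinM /= -mulr_natl.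
  by field; lra.
rewrite (_ : _ * _ = 2 * fine (davg (f \_ D) a e)); last by field; lra.
rewrite -ler_pdivlMl//.
near: e.
move/cvgrPdist_le : lim0 => /(_ (2^-1 * eps)) H.
have /H : 0 < 2^-1 * eps by rewrite mulr_gt0.
apply: filterS => e /=; rewrite sub0r normrN; exact: le_trans (ler_norm _).
Unshelve. all: by end_near. Qed.

(** The step and the indicator of ]a, L[ differ by at most 1, and only on a ball
    of measure 2 e: absolute continuity of the integral concludes. *)
Lemma cvg_step_average g a : mu.-integrable D (EFin \o g) -> D a ->
  \int[mu]_(x in D) (g x * step ((x - a) / e)) @[e --> 0^'+] -->
  \int[mu]_(x in `]a, L[) g x.
Proof.
move=> intg Da.
have mD : measurable (D : set (measurableTypeR R)) by exact: measurable_itv.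
have intG := Rintegrable_restrict mD intg.
have aD : (`]a, L[ : set R) `<=` D.
  move: Da; rewrite /= in_itv/= => /andP[a0 _].
  by move=> x /=; rewrite !in_itv/= => /andP[? ->]; rewrite andbT; lra.
pose H x : R := (a < x)%R%:R.
have HE : \int[mu]_(x in `]a, L[) g x = \int[mu]_(x in D) (g x * H x).
  rewrite [RHS](@Rintegral_support _ _ _ mu _ _ _ aD); last first.
    move=> x /=; rewrite !in_itv/= => /andP[_ xL] /negP.
    by rewrite negb_and xL orbF /H => /negbTE ->; rewrite mulr0.
  apply: eq_Rintegral => x /set_mem /=; rewrite in_itv/= => /andP[ax _].
  by rewrite /H ax mulr1.
have mH : measurable_fun setT H.
  rewrite (_ : H = \1_`]a, +oo[).
    by apply: measurable_indic; exact: measurable_itv.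
  by apply/funext => x; rewrite indicE mem_setE in_itv/= andbT.
have bH : [bounded H x : R^o | x in D].
  exists 1; split => // M M1 x _ /=.
  by rewrite /H; case: (_ < _); rewrite ?normr1 ?normr0; lra.
have mS e := measurable_step e a.
rewrite HE; apply/cvgrPdist_le => eps eps0.
have [d [d0 dP]] := integral_normr_continuous intG eps0.
near=> e.
have e0 : 0 < e by [].
have mB : measurable (ball a e : set (measurableTypeR R)) by exact: measurable_ball.
have [ae aeL] : 0 < a - e /\ a + e < L by near: e; exact: near0_ball.
have BD : ball a e `<=` D.
  by rewrite ball_itv => x /=; rewrite !in_itv/= => /andP[? ?]; lra.
have i1 := @Rintegrable_bounded _ _ _ mu _ _ _ mD mH bH intg.
have i2 := @Rintegrable_bounded _ _ _ mu _ _ _ mD (mS e) (@step_bounded e a D) intg.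
rewrite -RintegralB//; apply: le_trans (le_normr_Rintegral _ _) _ => //.
  exact: RintegrableB.
apply: le_trans (ltW (dP (ball a e) mB _)); last first.
  rewrite [X in (X < _)%E]lebesgue_measure_ball ?(ltW e0)// lte_fin -mulr_natr.
  rewrite -ltr_pdivlMr//; near: e; apply: nbhs_right_lt.
  by rewrite divr_gt0.
rewrite (@Rintegral_support _ _ _ mu D (ball a e))//; last first.
  move=> x _; rewrite -ball_normE /= => /negP; rewrite -leNgt => ex.
  apply/eqP; rewrite normr_eq0 -mulrBr mulf_eq0; apply/orP; right.
  rewrite /H; have [ax|xa] := ltP a x.
    rewrite step_eq1 ?subrr// ler_pdivlMr// mul1r.
    by move: ex; rewrite distrC ger0_norm; lra.
  rewrite step_eq0 ?subrr// ler_pdivrMr// mulN1r.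
  by move: ex; rewrite ger0_norm; lra.
apply: le_Rintegral => //.
- by apply: integrable_norm; apply: integrableS (RintegrableB mD i1 i2).
- by apply: integrable_norm; apply: integrableS intG.
- move=> x Bx; rewrite patchE mem_set; last exact: BD.
  rewrite -mulrBr normrM ler_piMr//.
  have /andP[? ?] := step_bounds ((x - a) / e).
  rewrite /H; case: (a < x); rewrite ler_norml /=; apply/andP; split; lra.
Unshelve. all: by end_near. Qed.

End weak_derivative.

Section primitive.
Context (R : realType).
Notation mu := (@lebesgue_measure R).
Notation RM := (measurableTypeR R).
Implicit Types (f g G v w : R -> R) (a b e x y L : R).

(** Base point -oo: the integrands of interest are extended by 0 outside of an
    interval, so no base point has to be carried along. *)
Definition primitive G x : R := \int[mu]_(y in `]-oo, x]) G y.

Lemma primitiveB G x y : mu.-integrable setT (EFin \o G) -> x <= y ->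
  primitive G y - primitive G x = \int[mu]_(t in `]x, y]) G t.
Proof.
move=> intG xy; rewrite /primitive Rintegral_itvB//.
by apply: integrableS intG.
Qed.

Lemma primitiveN G x : mu.-integrable setT (EFin \o G) ->
  primitive G x + \int[mu]_(t in `]x, +oo[) G t = \int[mu]_t G t.
Proof.
move=> intG; rewrite /primitive -set_itvNyy -(@Rintegral_itvB _ G -oo%O +oo%O x) //.
  by rewrite addrC subrK.
by rewrite set_itvNyy.
Qed.

Lemma continuous_primitive G : mu.-integrable setT (EFin \o G) ->
  continuous (primitive G).
Proof.
move=> intG x; apply/cvgrPdist_le => eps eps0.
have [d [d0 dP]] := integral_normr_continuous intG eps0.
have bnd a b : a <= b -> b - a < d -> `|primitive G b - primitive G a| <= eps.
  move=> ab bad; rewrite primitiveB//.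
  have mI : measurable (`]a, b] : set RM) by exact: measurable_itv.
  have intI : mu.-integrable (`]a, b] : set RM) (EFin \o G).
    by apply: integrableS intG.
  apply: le_trans (le_normr_Rintegral mI intI) _.
  apply/ltW/dP => //; rewrite [X in (X < _)%E]lebesgue_measure_itv/=.
  by case: ifP => // _; rewrite -EFinB lte_fin.
near=> y.
have dxy : `|x - y| < d by near: y; exact: cvgr_dist_lt.
have [xy|/ltW yx] := leP x y.
  rewrite distrC; apply: bnd => //.
  by move: dxy; rewrite distrC ger0_norm// subr_ge0.
by apply: bnd => //; move: dxy; rewrite ger0_norm// subr_ge0.
Unshelve. all: by end_near. Qed.

Lemma Rintegrable_mul_primitive (h k : R -> R) :
  mu.-integrable setT (EFin \o h) -> mu.-integrable setT (EFin \o k) ->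
  mu.-integrable setT (EFin \o (fun t => h t * primitive k t)).
Proof.
move=> inth intk; apply: (@Rintegrable_bounded _ _ _ mu) inth => //.
  by apply: continuous_measurable_fun; exact: continuous_primitive.
exists (\int[mu]_t `|k t|); split; first exact: num_real.
move=> M kM x _; apply: le_trans (ltW kM); rewrite /= /primitive.
have intkx : mu.-integrable (`]-oo, x] : set RM) (EFin \o k).
  by apply: integrableS intk.
apply: le_trans (le_normr_Rintegral _ intkx) _ => //.
rewrite Rintegral_mkcond; apply: le_Rintegral => //.
- exact: (Rintegrable_restrict _ (integrable_norm intkx)).
- exact: integrable_norm.
- by move=> t _; rewrite patchE; case: ifP => // _; exact: normr_ge0.
Qed.

(** Fubini's theorem for w(x) v(y) on the half-plane y <= x.  It holds for
    merely integrable v and w, whose primitives need not be differentiable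
    everywhere. *)
Lemma primitive_by_parts v w :
  mu.-integrable setT (EFin \o v) -> mu.-integrable setT (EFin \o w) ->
  \int[mu]_x (w x * primitive v x) + \int[mu]_x (v x * primitive w x)
  = (\int[mu]_x w x) * (\int[mu]_x v x).
Proof.
move=> intv intw.
pose F (z : RM * RM) : R := w z.1 * v z.2 * (z.2 <= z.1)%R%:R.
have mv : measurable_fun setT v by exact: Rintegrable_measurable intv.
have mw : measurable_fun setT w by exact: Rintegrable_measurable intw.
have mF : measurable_fun setT F.
  apply: measurable_funM.
    apply: measurable_funM; first exact: (measurableT_comp mw).
    exact: (measurableT_comp mv).
  rewrite (_ : (fun z : RM * RM => _) = \1_[set z : RM * RM | z.2 <= z.1]).
    apply: measurable_indic; rewrite -[X in measurable X]setTI.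
    have := @measurable_fun_ler _ _ R setT (fun z : RM * RM => z.2)
      (fun z => z.1) measurable_snd measurable_fst.
    by move=> /(_ measurableT [set true]); apply.
  by apply/funext => z; rewrite indicE mem_setE.
have int_section (h : R -> R) (A : set RM) c : measurable A ->
    mu.-integrable setT (EFin \o h) ->
    mu.-integrable setT (EFin \o (fun t => c * h t * \1_A t)).
  move=> mA inth.
  apply: (@Rintegrable_bounded _ _ _ mu) (RintegrableZ measurableT c inth) => //.
  exists 1; split => // M M1 x _; apply: le_trans (ltW M1).
  by rewrite /= indicE; case: (_ \in _); rewrite ?normr1 ?normr0.
have secE (h : R -> R) (A : set RM) c : measurable A ->
    mu.-integrable setT (EFin \o h) ->
    (\int[mu]_t (c * h t * \1_A t)%:E = (c * \int[mu]_(t in A) h t)%:E)%E.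
  move=> mA inth; have := int_section h A c mA inth.
  move=> /integrable_fin_num /fineK <- //; congr EFin.
  rewrite -RintegralZl//; last by apply: integrableS inth.
  rewrite -[LHS]/(\int[mu]_t (c * h t * \1_A t)).
  rewrite (@Rintegral_support _ _ _ mu setT A)//.
    by apply: eq_Rintegral => t tA; rewrite indicE tA mulr1.
  by move=> t _ /asboolPn At; rewrite indicE memNset ?mulr0//; exact/asboolPn.
have FE1 x : (\int[mu]_y (F (x, y))%:E = (w x * primitive v x)%:E)%E.
  rewrite /primitive -secE//; apply: eq_integral => y _.
  by rewrite /F/= indicE mem_setE in_itv.
have FE2 y : (\int[mu]_x (F (x, y))%:E =
    (v y * \int[mu]_(t in `[y, +oo[) w t)%:E)%E.
  rewrite -secE//; apply: eq_integral => x _.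
  by rewrite /F/= indicE mem_setE in_itv/= andbT [w x * _]mulrC.
have intF : (mu \x mu)%E.-integrable setT (EFin \o F).
  apply/integrable12ltyP; first exact/measurable_EFinP.
  have wfin := integrable_fin_num measurableT (integrable_norm intw).
  have vfin := integrable_fin_num measurableT (integrable_norm intv).
  pose C : R := \int[mu]_t `|v t|.
  apply: (@le_lt_trans _ _ (\int[mu]_x (C * `|w x|)%:E)%E).
    apply: ge0_le_integral => //.
    - by move=> x _; exact: integral_ge0.
    - have mFE : measurable_fun setT (fun z : RM * RM => `|(F z)%:E|%E).
        by apply: measurableT_comp => //; exact/measurable_EFinP.
      exact: (measurable_fun_fubini_tonelli_F (m2 := mu) _ mFE (fun=> abse_ge0 _)).
    - apply/measurable_EFinP; apply: measurable_funM => //.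
      exact: measurableT_comp.
    - move=> x _.
      have -> : (C * `|w x|)%:E = (\int[mu]_y (`|w x| * `|v y|)%:E)%E.
        rewrite mulrC EFinM /C /Rintegral fineK//.
        by rewrite -ge0_integralZl_EFin//; exact/measurable_EFinP/measurableT_comp.
      apply: ge0_le_integral => //.
      + have mFx : measurable_fun setT (fun y : RM => F (x, y)).
          exact: measurable_fun_pair2 mF.
        by apply: measurableT_comp => //; exact/measurable_EFinP.
      + apply/measurable_EFinP; apply: measurable_funM => //.
        exact: measurableT_comp.
      + move=> y _; rewrite /= lee_fin /F /= !normrM ler_piMr//.
        by case: (y <= x); rewrite ?normr1 ?normr0.
  exact: (integrable_lty measurableT
    (RintegrableZ measurableT C (integrable_norm intw))).
have -> : \int[mu]_x (w x * primitive v x) =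
    \int[mu]_y (v y * (\int[mu]_x w x - primitive w y)).
  rewrite /Rintegral; congr fine.
  under eq_integral do rewrite -FE1.
  rewrite (@Fubini _ _ _ _ _ mu mu (EFin \o F))//=.
  apply: eq_integral => y _; rewrite FE2; congr (_ * _)%:E.
  rewrite -[X in _ = X - _](primitiveN y intw) addrAC subrr add0r.
  rewrite Rintegral_itv_obnd_cbnd//.
  by apply: integrableS intw.
under eq_Rintegral do rewrite mulrBr.
rewrite RintegralB//; last exact: Rintegrable_mul_primitive; last first.
  under [X in _.-integrable _ (_ \o X)]eq_fun do rewrite mulrC.
  exact: RintegrableZ.
rewrite subrK; under eq_Rintegral do rewrite mulrC.
by rewrite RintegralZl.
Qed.
End primitive.

Section weak_primitive.
Context (R : realType).
Notation mu := (@lebesgue_measure R).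
Notation RM := (measurableTypeR R).
Variable L : R.
Notation D := (`]0, L[%classic : set RM).
Implicit Types (f g : R -> R).

Lemma primitive_Rintegral_right g x : mu.-integrable D (EFin \o g) -> D x ->
  primitive (g \_ D) x + \int[mu]_(t in `]x, L[) g t = \int[mu]_(t in D) g t.
Proof.
move=> intg; rewrite /= in_itv/= => /andP[x0 xL].
rewrite -(@Rintegral_itvB _ g (BRight 0) (BLeft L) x) ?bnd_simp ?ltW//.
suff -> : primitive (g \_ D) x = \int[mu]_(t in `]0, x]) g t.
  by rewrite addrC subrK.
rewrite /primitive (@Rintegral_support _ _ _ mu _ (`]0, x] : set RM)).
- apply: Rintegral_patch => t /=; rewrite !in_itv/= => /andP[-> tx].
  exact: le_lt_trans tx xL.
- by move=> t /=; rewrite !in_itv/= => /andP[_ ->].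
- move=> t /=; rewrite !in_itv/= => tx /negP; rewrite tx andbT => t0.
  by rewrite patchE memNset//= in_itv/= (negbTE t0).
Qed.

(** At Lebesgue points a and b of f, testing against the difference of the steps
    of width e at a and b gives, as e tends to 0,
      f a - f b = - (\int_a^L g - \int_b^L g).
    So f + \int_x^L g takes the same value at all Lebesgue points, that is
    almost everywhere. *)
Lemma weak_derivative_primitive f g :
  mu.-integrable D (EFin \o f) -> mu.-integrable D (EFin \o g) ->
  (forall phi, test_function L phi ->
    \int[mu]_(x in D) (f x * derive1 phi x)
    = - \int[mu]_(x in D) (g x * phi x)) ->
  exists k, {ae mu, forall x, D x -> f x = k + primitive (g \_ D) x}.
Proof.
move=> intf intg fg; have mD : measurable D by exact: measurable_itv.
have intF := Rintegrable_restrict mD intf.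
pose Q x : R := \int[mu]_(t in `]x, L[) g t.
have key a b : D a -> D b -> lebesgue_pt (f \_ D) a -> lebesgue_pt (f \_ D) b ->
    f a + Q a = f b + Q b.
  move=> Da Db pa pb.
  have lhs := cvgB (cvg_tent_average intf Da pa) (cvg_tent_average intf Db pb).
  have rhs := cvgN (cvgB (cvg_step_average intg Da) (cvg_step_average intg Db)).
  suff : f a - f b = - (Q a - Q b) by lra.
  apply: (norm_cvg_unique (lhs _)); apply: cvg_trans (rhs _ _); apply: near_eq_cvg.
  near=> e.
  have e0 : 0 < e by [].
  have [ae aeL] : 0 < a - e /\ a + e < L by near: e; exact: near0_ball.
  have [be beL] : 0 < b - e /\ b + e < L by near: e; exact: near0_ball.
  have intS c (h : R -> R) : mu.-integrable D (EFin \o h) ->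
      mu.-integrable D (EFin \o (fun x => h x * step ((x - c) / e))).
    move=> ih; apply: (@Rintegrable_bounded _ _ _ mu) ih => //.
      exact: measurable_step.
    exact: step_bounded.
  have intT c (h : R -> R) : mu.-integrable D (EFin \o h) ->
      mu.-integrable D (EFin \o (fun x => h x * (e^-1 * tent ((x - c) / e)))).
    move=> ih; apply: (@Rintegrable_bounded _ _ _ mu) ih => //.
      exact: measurable_tent.
    exact: tent_bounded.
  have := fg _ (test_function_steps e0 ae aeL be beL).
  under eq_Rintegral do rewrite derive1_steps mulrBr.
  rewrite RintegralB//; [|exact: intT|exact: intT].
  move=> lhsE; rewrite -[RHS]/(_ - _) lhsE.
  under eq_Rintegral do rewrite mulrBr.
  by rewrite RintegralB//; exact: intS.
have leb : {ae mu, forall x, lebesgue_pt (f \_ D) x}.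
  apply: lebesgue_differentiation; apply: open_integrable_locally => //.
  exact: openT.
have [[a [Da pa]]|noleb] := pselect (exists a, D a /\ lebesgue_pt (f \_ D) a).
  exists (f a - primitive (g \_ D) a).
  apply: (@filterS _ _ (ae_filter_ringOfSetsType mu) _ _ _ leb) => x px Dx.
  have := key _ _ Dx Da px pa.
  have := primitive_Rintegral_right intg Da.
  have := primitive_Rintegral_right intg Dx.
  rewrite -/(Q x) -/(Q a); lra.
exists 0; apply: (@filterS _ _ (ae_filter_ringOfSetsType mu) _ _ _ leb) => x px Dx.
by exfalso; apply: noleb; exists x.
Unshelve. all: by end_near. Qed.

End weak_primitive.

(** * Integration by parts under the Neumann condition *)

Section neumann.
Context (R : realType).
Notation mu := (@lebesgue_measure R).
Notation RM := (measurableTypeR R).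
Variable L : R.
Notation D := (`]0, L[%classic : set RM).
Implicit Types (f g h : R -> R).

Lemma ae_itv_ex (P : R -> Prop) a b : a < b -> {ae mu, forall x, P x} ->
  exists x, a < x < b /\ P x.
Proof.
move=> ab [N [mN N0 PN]]; apply: contrapT => noP.
have sub : (`]a, b[ : set RM) `<=` N.
  move=> x /=; rewrite in_itv/= => xab; apply: PN => Px; apply: noP.
  by exists x.
have : (mu (`]a, b[ : set RM) <= mu N)%E.
  by apply: le_measure => //; rewrite inE//; exact: measurable_itv.
rewrite [X in (X <= _)%E]lebesgue_measure_itv/= lte_fin ab N0 -EFinB lee_fin.
lra.
Qed.

Lemma primitive0 g : primitive (g \_ D) 0 = 0.
Proof.
rewrite /primitive (@Rintegral_support _ _ _ mu _ set0) ?Rintegral_set0//.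
move=> x /=; rewrite in_itv/= => x0 _.
by rewrite patchE memNset//= in_itv/= => /andP[]; lra.
Qed.

Lemma primitiveL g : mu.-integrable D (EFin \o g) -> 0 < L ->
  primitive (g \_ D) L = \int[mu]_(x in D) g x.
Proof.
move=> intg L0; rewrite /primitive (@Rintegral_support _ _ _ mu _ D).
- exact: Rintegral_patch.
- by move=> x /=; rewrite !in_itv/= => /andP[_ /ltW].
- by move=> x _ nDx; rewrite patchE memNset.
Qed.

(** A set of full measure accumulates at both ends, so it determines the
    one-sided limits there. *)
Lemma continuous_ae0_boundary h : 0 < L -> {within `[0, L], continuous h} ->
  {ae mu, forall x, D x -> h x = 0} -> h 0 = 0 /\ h L = 0.
Proof.
move=> L0 /(continuous_within_itvP _ L0)[_ h0 hL] hae.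
split; apply/eqP; rewrite -normr_le0; apply/ler_addgt0Pl => e e0; rewrite addr0.
- have [d d0 dP] := (iffLR (cvgrPdist_lt _ _) h0) e e0.
  have dL : 0 < Num.min d L by rewrite lt_min d0 L0.
  have [x [/andP[x0]]] := ae_itv_ex dL hae; rewrite lt_min => /andP[xd xL] hx.
  have := dP x; rewrite /= sub0r normrN gtr0_norm// => /(_ xd x0).
  by rewrite hx ?subr0 => [/ltW//|]; rewrite /= in_itv/= x0.
- have [d d0 dP] := (iffLR (cvgrPdist_lt _ _) hL) e e0.
  have dL : Num.max (L - d) 0 < L.
    by rewrite gt_max L0 andbT; move: d0; rewrite /=; lra.
  have [x [/andP[]]] := ae_itv_ex dL hae; rewrite gt_max => /andP[xd x0] xL hx.
  have := dP x; rewrite /= gtr0_norm ?subr_gt0// => H.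
  have := H _ xL; rewrite hx ?subr0 => [|]; last by rewrite /= in_itv/= x0.
  by move=> H'; apply/ltW/H'; lra.
Qed.

(** The continuous representative c and k + primitive agree almost everywhere,
    hence also at 0, which gives k = 0, and at L, which gives a zero integral. *)
Lemma neumann_primitive k (c g g1 : R -> R) : 0 < L ->
  mu.-integrable D (EFin \o g1) ->
  {ae mu, forall x, D x -> g x = k + primitive (g1 \_ D) x} ->
  {within `[0, L], continuous c} -> {ae mu, forall x, D x -> g x = c x} ->
  c 0 = 0 -> c L = 0 ->
  {ae mu, forall x, D x -> g x = primitive (g1 \_ D) x} /\
  \int[mu]_(x in D) g1 x = 0.
Proof.
move=> L0 int1 gk cc gc c0 cL; have mD : measurable D by exact: measurable_itv.
pose h x := c x - (k + primitive (g1 \_ D) x).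
have [] := @continuous_ae0_boundary h L0.
- move=> x; apply: cvgB; first exact: cc.
  apply: cvgD; first exact: cvg_cst.
  apply: continuous_subspaceT; apply: continuous_primitive.
  exact: Rintegrable_restrict.
- by apply: (@filterS2 _ _ (ae_filter_ringOfSetsType mu)) gk gc => x e1 e2 Dx;
    rewrite /h -e1// e2// subrr.
- rewrite /h c0 cL primitive0 primitiveL// => k0 I0.
  have k00 : k = 0 by lra.
  split; last by lra.
  apply: (@filterS _ _ (ae_filter_ringOfSetsType mu)) gk => x + Dx.
  by move=> /(_ Dx) ->; rewrite k00 add0r.
Qed.

(** The constant k is multiplied by the zero integral of g1, and so is the
    right-hand side of primitive_by_parts: no boundary term is left. *)
Lemma primitive_integration_by_parts k f f1 g g1 :
  sqintegrable mu D f -> sqintegrable mu D f1 ->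
  sqintegrable mu D g -> sqintegrable mu D g1 ->
  {ae mu, forall x, D x -> f x = k + primitive (f1 \_ D) x} ->
  {ae mu, forall x, D x -> g x = primitive (g1 \_ D) x} ->
  \int[mu]_(x in D) g1 x = 0 ->
  \int[mu]_(x in D) (g1 x * f x) = - \int[mu]_(x in D) (g x * f1 x).
Proof.
move=> hf hf1 hg hg1 fE gE g10; have mD : measurable D by exact: measurable_itv.
have Dfin : (mu D < +oo)%E.
  by rewrite [X in (X < _)%E]lebesgue_measure_itv/=; case: ifP; rewrite ?ltry.
have i1 := sqintegrable_Rintegrable mD Dfin hf1.
have i2 := sqintegrable_Rintegrable mD Dfin hg1.
have j1 := Rintegrable_restrict mD i1; have j2 := Rintegrable_restrict mD i2.
have := primitive_by_parts j1 j2.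
rewrite -[X in _ = X * _]Rintegral_mkcond g10 mul0r.
have E (h w : R -> R) : \int[mu]_x ((h \_ D) x * primitive (w \_ D) x) =
    \int[mu]_(x in D) (h x * primitive (w \_ D) x).
  rewrite (@Rintegral_support _ _ _ mu _ D)//.
    by apply: eq_Rintegral => x Dx; rewrite patchE Dx.
  by move=> x _ nDx; rewrite patchE memNset// mul0r.
have I (h w : R -> R) :
    mu.-integrable D (EFin \o h) -> mu.-integrable D (EFin \o w) ->
    mu.-integrable D (EFin \o (fun x => h x * primitive (w \_ D) x)).
  move=> ih iw.
  have := Rintegrable_mul_primitive (Rintegrable_restrict mD ih)
    (Rintegrable_restrict mD iw).
  move=> /(integrableS measurableT mD (@subsetT _ _)).
  by apply: eq_integrable => // x Dx; rewrite /= patchE Dx.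
rewrite !E => /eqP; rewrite addr_eq0 => /eqP PE.
have -> : \int[mu]_(x in D) (g1 x * f x) =
    \int[mu]_(x in D) (k * g1 x + g1 x * primitive (f1 \_ D) x).
  apply: ae_eq_Rintegral => //.
  - exact: sqintegrable_mul.
  - by apply: RintegrableD => //; [exact: RintegrableZ|exact: I].
  - apply: (@filterS _ _ (ae_filter_ringOfSetsType mu)) fE => x + Dx.
    by move=> /(_ Dx) ->; ring.
rewrite RintegralD//; [|exact: RintegrableZ|exact: I].
rewrite RintegralZl// g10 mulr0 add0r PE; congr (- _).
apply: ae_eq_Rintegral => //; [exact: I|exact: sqintegrable_mul|].
apply: (@filterS _ _ (ae_filter_ringOfSetsType mu)) gE => x + Dx.
by move=> /(_ Dx) ->; ring.
Qed.

End neumann.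

(** * Poincare inequality and feedback on the cells *)

Section poincare.
Context (R : realType).
Notation mu := (@lebesgue_measure R).
Notation RM := (measurableTypeR R).
Variable L : R.
Notation D := (`]0, L[%classic : set RM).
Implicit Types (f g h : R -> R).

Lemma lebesgue_measure_itvoo (a b : R) :
  a < b -> mu (`]a, b[ : set RM) = (b - a)%:E.
Proof. by move=> ab; rewrite [LHS]lebesgue_measure_itv/= lte_fin ab EFinB. Qed.

Lemma sqintegrableS (A B : set RM) f : measurable A -> measurable B -> A `<=` B ->
  sqintegrable mu B f -> sqintegrable mu A f.
Proof.
move=> mA mB AB [mf f2]; split; first exact: measurable_funS mf.
exact: integrableS f2.
Qed.

(** Among constants, the mean is the best quadratic approximation of f, so f may
    be compared instead with its value at the left end of the cell, from which
    it deviates by at most \int |g|.  This gives the constant 1 where the sharp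
    one is 1 / pi^2; any constant up to 1 leads to the rate of the theorem. *)
Lemma poincare_cell k f g (a b : R) : 0 <= a -> a < b -> b <= L ->
  sqintegrable mu D f -> sqintegrable mu D g ->
  {ae mu, forall x, D x -> f x = k + primitive (g \_ D) x} ->
  \int[mu]_(x in `]a, b[) f x ^+ 2 <=
    (\int[mu]_(x in `]a, b[) f x) ^+ 2 / (b - a)
    + (b - a) ^+ 2 * \int[mu]_(x in `]a, b[) g x ^+ 2.
Proof.
move=> a0 ab bL hf hg fE; pose I : set RM := `]a, b[%classic.
have mD : measurable D by exact: measurable_itv.
have mI : measurable I by exact: measurable_itv.
have muI : mu I = (b - a)%:E by exact: lebesgue_measure_itvoo.
have fI : (mu I < +oo)%E by rewrite muI ltry.
have ID : I `<=` D.
  move=> x /=; rewrite !in_itv/= => /andP[ax xb].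
  by rewrite (le_lt_trans a0 ax) (lt_le_trans xb bL).
have hfI : sqintegrable mu I f by exact: sqintegrableS hf.
have hgI : sqintegrable mu I g by exact: sqintegrableS hg.
have intgD : mu.-integrable D (EFin \o g).
  have L0 : 0 < L by lra.
  apply: sqintegrable_Rintegrable => //.
  by rewrite [X in (X < _)%E]lebesgue_measure_itvoo ?ltry.
have h1 : sqintegrable mu I (cst 1).
  split; first exact: measurable_cst.
  exact: (Rintegrable_cst mI (1 ^+ 2) fI).
have int1 c : mu.-integrable I (EFin \o cst c) by exact: Rintegrable_cst.
have I1 c : \int[mu]_(x in I) c = c * (b - a).
  by rewrite Rintegral_cst// [X in _ * fine X]muI.
have hng : sqintegrable mu I (fun x => `|g x|).
  case: hgI => mg ig; split; first exact: measurableT_comp.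
  by apply: eq_integrable ig => // x _; rewrite /= real_normK ?num_real.
pose l := b - a; have l0 : 0 < l by rewrite subr_gt0.
pose S := \int[mu]_(x in I) f x; pose G := \int[mu]_(x in I) g x ^+ 2.
have G0 : 0 <= G by apply: Rintegral_ge0 => x _; exact: sqr_ge0.
(* The value at a of the continuous representative of f. *)
pose c0 := k + primitive (g \_ D) a.
have osc : {ae mu, forall x, I x -> (f x - c0) ^+ 2 <= l * G}.
  apply: (@filterS _ _ (ae_filter_ringOfSetsType mu)) fE => x + Ix.
  move=> /(_ (ID _ Ix)) ->; rewrite /c0 opprD addrACA subrr add0r.
  move: (Ix); rewrite /I/= in_itv/= => /andP[ax xb].
  rewrite primitiveB ?(ltW ax)//; last exact: Rintegrable_restrict.
  have sub : (`]a, x] : set RM) `<=` I.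
    move=> y; rewrite /I/= !in_itv/= => /andP[-> yx].
    exact: le_lt_trans yx xb.
  rewrite Rintegral_patch; last exact: subset_trans ID.
  have ig : mu.-integrable I (EFin \o g) by exact: sqintegrable_Rintegrable.
  have igx : mu.-integrable (`]a, x] : set RM) (EFin \o g).
    by apply: integrableS ig.
  have CS := Cauchy_Schwarz_Rintegral mI hng h1.
  have le1 : `|\int[mu]_(t in `]a, x]) g t| <= \int[mu]_(t in I) `|g t|.
    apply: le_trans (le_normr_Rintegral _ igx) _ => //.
    rewrite Rintegral_mkcond [leRHS]Rintegral_mkcond; apply: le_Rintegral => //.
    - exact: (Rintegrable_restrict _ (integrable_norm igx)).
    - exact: (Rintegrable_restrict _ (integrable_norm ig)).
    - move=> t _; rewrite !patchE; case: ifPn => [/set_mem/sub It|_].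
        by rewrite mem_set.
      by case: ifPn => // _; exact: normr_ge0.
  rewrite -real_normK ?num_real//.
  apply: (@le_trans _ _ ((\int[mu]_(t in I) `|g t|) ^+ 2)).
    by rewrite lerXn2r// nnegrE// Rintegral_ge0.
  move: CS; under eq_Rintegral do rewrite mulr1.
  move=> /le_trans; apply; rewrite mulrC.
  under eq_Rintegral do rewrite expr1n.
  rewrite I1 mul1r -/l; under eq_Rintegral do rewrite real_normK ?num_real//.
  exact: lexx.
have hfc : sqintegrable mu I (fun x => f x - c0).
  apply: sqintegrableB => //; split; first exact: measurable_cst.
  exact: (Rintegrable_cst mI (c0 ^+ 2) fI).
have : \int[mu]_(x in I) (f x - c0) ^+ 2 <= \int[mu]_(x in I) (l * G).
  by apply: ae_le_Rintegral => //; [exact: hfc.2|exact: int1].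
rewrite I1 -/l.
have -> : \int[mu]_(x in I) (f x - c0) ^+ 2
    = \int[mu]_(x in I) f x ^+ 2 - 2 * c0 * S + c0 ^+ 2 * l.
  have ifI : mu.-integrable I (EFin \o f) by exact: sqintegrable_Rintegrable.
  have -> : \int[mu]_(x in I) (f x - c0) ^+ 2 =
      \int[mu]_(x in I) (f x ^+ 2 - 2 * c0 * f x + c0 ^+ 2).
    by apply: eq_Rintegral => x _; ring.
  rewrite RintegralD//; last exact: int1; last first.
    by apply: RintegrableB => //; [exact: hfI.2|exact: RintegrableZ].
  rewrite RintegralB//; [|exact: hfI.2|exact: RintegrableZ].
  by rewrite RintegralZl// I1.
rewrite -/I -/S -/G -/l => H.
(* The mean S / l is closer to f than c0 is. *)
have : 0 <= (S - c0 * l) ^+ 2 / l by rewrite divr_ge0 ?sqr_ge0// ltW.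
have -> : (S - c0 * l) ^+ 2 / l = S ^+ 2 / l - 2 * c0 * S + c0 ^+ 2 * l.
  by field; rewrite gt_eqF.
nra.
Qed.

End poincare.

Section cells.
Context (R : realType).
Notation mu := (@lebesgue_measure R).
Notation RM := (measurableTypeR R).
Variables (L : R) (N : nat).
Hypotheses (L0 : 0 < L) (N0 : (0 < N)%N).
Notation D := (`]0, L[%classic : set RM).
Notation h := (L / N%:R).
Implicit Types (f g F : R -> R).

Definition real_average (A : set R) f : R :=
  (fine (mu A))^-1 * \int[mu]_(x in A) f x.

Definition cell_averages f (x : R) : R :=
  \sum_(1 <= k < N.+1) real_average (J L N k) f * \1_(J L N k) x.

Let h0 : 0 < h. Proof. by rewrite divr_gt0// ltr0n. Qed.
Let NhL : N%:R * h = L. Proof. by field; rewrite pnatr_eq0 -lt0n. Qed.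

Lemma J_succ k : J L N k.+1 = `[k%:R * h, k.+1%:R * h[%classic.
Proof.
by rewrite /J -natr1 addrK mulrA [X in `[_, X[]mulrA.
Qed.

Lemma cell_averages_in f n x : measurable_fun D f -> (n < N)%N ->
  n%:R * h < x < n.+1%:R * h ->
  cell_averages f x = h^-1 * \int[mu]_(y in `]n%:R * h, n.+1%:R * h[) f y.
Proof.
move=> mf nN /andP[nx xn].
have mono (i j : nat) : (i <= j)%N -> i%:R * h <= j%:R * h.
  by move=> ij; rewrite ler_pM2r// ler_nat.
rewrite /cell_averages (bigD1_seq n.+1) ?mem_index_iota ?iota_uniq//=.
rewrite big1_seq ?addr0 => [|k /andP[kn]]; last first.
  rewrite mem_index_iota; case: k kn => // k kn _.
  rewrite J_succ indicE memNset ?mulr0//= in_itv/= => /andP[kx xk].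
  move: kn; rewrite eqSS neq_ltn => /orP[|] /mono; lra.
rewrite J_succ indicE mem_set ?mulr1; last by rewrite /= in_itv/= xn ltW.
rewrite /real_average.
have ab : n%:R * h < n.+1%:R * h by rewrite ltr_pM2r// ltr_nat.
congr (_ * _).
  by rewrite [X in fine X]lebesgue_measure_itv/= lte_fin ab/= -mulrBl -natr1;
    congr (_^-1); ring.
rewrite /Rintegral integral_itv_bndoo//; apply/measurable_EFinP.
apply: measurable_funS mf => // y; rewrite /= !in_itv/= => /andP[ny yn].
rewrite (le_lt_trans _ ny) ?(mulr_ge0 _ (ltW h0))//.
by rewrite (lt_le_trans yn)// -[leRHS]NhL ler_pM2r// ler_nat.
Qed.

Lemma Rintegral_itv_split F (a b c : R) : a < c -> c < b ->
  mu.-integrable (`]a, b[ : set RM) (EFin \o F) ->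
  \int[mu]_(x in `]a, b[) F x =
    \int[mu]_(x in `]a, c[) F x + \int[mu]_(x in `]c, b[) F x.
Proof.
move=> ac cb intF.
rewrite -(@Rintegral_itvB _ F (BRight a) (BLeft b) c) ?bnd_simp ?(ltW ac)//.
rewrite (@Rintegral_itv_bndo_bndc _ (BRight a) c); last first.
  apply: integrableS intF => //= x /=; rewrite !in_itv/= => /andP[-> xc].
  exact: lt_trans xc cb.
by rewrite addrC subrK.
Qed.

Lemma Rintegral_cells_ge0 F : mu.-integrable D (EFin \o F) ->
  (forall n, (n < N)%N -> 0 <= \int[mu]_(x in `]n%:R * h, n.+1%:R * h[) F x) ->
  0 <= \int[mu]_(x in D) F x.
Proof.
move=> intF cellF; rewrite -NhL.
suff H n : (n <= N)%N -> 0 <= \int[mu]_(x in `]0, (n%:R * h)[) F x by exact: H.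
elim: n => [_|n IH nN].
  by apply: Rintegral_ge0 => x; rewrite /= in_itv/= mul0r; lra.
have [->|n0] := eqVneq n 0%N; first by have := cellF 0%N N0; rewrite mul0r.
rewrite (@Rintegral_itv_split _ _ _ (n%:R * h)).
- by rewrite addr_ge0// ?IH ?cellF// ltnW.
- by rewrite mulr_gt0// ltr0n lt0n.
- by rewrite ltr_pM2r// ltr_nat.
- apply: integrableS intF => //= x /=; rewrite !in_itv/= => /andP[-> /lt_le_trans].
  by apply; rewrite -[leRHS]NhL ler_pM2r// ler_nat.
Qed.

Lemma Rintegrable_cell_averages f g : mu.-integrable D (EFin \o g) ->
  mu.-integrable D (EFin \o (fun x => g x * cell_averages f x)).
Proof.
move=> intg; apply: (@Rintegrable_bounded _ _ _ mu) intg => //.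
  apply: measurable_sum => k; apply: measurable_funM => //.
  by apply: measurable_indic; exact: measurable_itv.
exists (\sum_(1 <= k < N.+1) `|real_average (J L N k) f|).
split; first exact: num_real.
move=> M leM x _; apply: le_trans (ltW leM).
apply: le_trans (ler_norm_sum _ _ _) _; apply: ler_sum => k _.
rewrite normrM ler_piMr// indicE; case: (_ \in _); by rewrite ?normr1 ?normr0.
Qed.

(** Within a cell, diffusion controls the oscillation of f and the feedback
    controls its mean.  The bound on the width h of the cells makes the first
    control, with constant lambda / h^2, at least as good as nu / 4. *)
Lemma cell_coercivity k (lambda nu : R) f g :
  0 <= nu -> nu * h ^+ 2 / 4 <= lambda ->
  sqintegrable mu D f -> sqintegrable mu D g ->
  {ae mu, forall x, D x -> f x = k + primitive (g \_ D) x} ->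
  nu / 4 * \int[mu]_(x in D) f x ^+ 2 <=
    lambda * \int[mu]_(x in D) g x ^+ 2
    + nu * \int[mu]_(x in D) (f x * cell_averages f x).
Proof.
move=> nu0 nul hf hg fE; have mD : measurable D by exact: measurable_itv.
have intf : mu.-integrable D (EFin \o f).
  apply: sqintegrable_Rintegrable => //.
  by rewrite [X in (X < _)%E]lebesgue_measure_itvoo// ltry.
have iA := Rintegrable_cell_averages f intf.
pose F x :=
  lambda * g x ^+ 2 + nu * (f x * cell_averages f x) - nu / 4 * f x ^+ 2.
have FE (I : set RM) : measurable I -> I `<=` D -> \int[mu]_(x in I) F x =
   lambda * \int[mu]_(x in I) g x ^+ 2
    + nu * \int[mu]_(x in I) (f x * cell_averages f x)
    - nu / 4 * \int[mu]_(x in I) f x ^+ 2.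
  move=> mI ID.
  have i1 : mu.-integrable I (EFin \o (fun x => g x ^+ 2)).
    by exact: integrableS hg.2.
  have i2 : mu.-integrable I (EFin \o (fun x => f x ^+ 2)).
    by exact: integrableS hf.2.
  have i3 : mu.-integrable I (EFin \o (fun x => f x * cell_averages f x)).
    exact: integrableS iA.
  rewrite RintegralB//; last exact: RintegrableZ; last first.
    by apply: RintegrableD => //; exact: RintegrableZ.
  rewrite RintegralD//; [|exact: RintegrableZ|exact: RintegrableZ].
  by rewrite !RintegralZl.
rewrite -subr_ge0 -FE//; apply: Rintegral_cells_ge0.
  apply: RintegrableB => //; last by apply: RintegrableZ => //; exact: hf.2.
  by apply: RintegrableD => //; apply: RintegrableZ => //; exact: hg.2.
move=> n nN; set a := n%:R * h; set b := n.+1%:R * h.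
have ab : a < b by rewrite ltr_pM2r// ltr_nat.
have a0 : 0 <= a by rewrite mulr_ge0// ltW.
have bL : b <= L by rewrite -[leRHS]NhL ler_pM2r// ler_nat.
have bah : b - a = h by rewrite /a /b -natr1; ring.
rewrite FE; last 2 first.
- exact: measurable_itv.
- move=> x /=; rewrite !in_itv/= => /andP[ax xb].
  by rewrite (le_lt_trans a0 ax) (lt_le_trans xb bL).
have := poincare_cell a0 ab bL hf hg fE; rewrite bah.
set S := \int[mu]_(x in `]a, b[) f x.
have -> : \int[mu]_(x in `]a, b[) (f x * cell_averages f x) = S ^+ 2 / h.
  transitivity (\int[mu]_(x in `]a, b[) (h^-1 * S * f x)).
    apply: eq_Rintegral => x /set_mem /=; rewrite in_itv/= => xab.
    by rewrite (cell_averages_in hf.1 nN)// mulrC.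
  rewrite RintegralZl//; last first.
    apply: integrableS intf => //= x /=; rewrite !in_itv/= => /andP[ax xb].
    by rewrite (le_lt_trans a0 ax) (lt_le_trans xb bL).
  by rewrite -/S expr2; ring.
set G := \int[mu]_(x in `]a, b[) g x ^+ 2.
have G0 : 0 <= G by apply: Rintegral_ge0 => x _; exact: sqr_ge0.
have S0 : 0 <= S ^+ 2 / h by rewrite divr_ge0 ?sqr_ge0// ltW.
set X := S ^+ 2 / h; set Y := \int[mu]_(x in `]a, b[) f x ^+ 2 => H.
have : nu / 4 * Y <= nu / 4 * (X + h ^+ 2 * G).
  by rewrite ler_wpM2l// divr_ge0.
have : nu * h ^+ 2 / 4 * G <= lambda * G by rewrite ler_wpM2r.
have : 0 <= nu * X by rewrite mulr_ge0.
lra.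
Qed.

End cells.

(** * The energy as a function of time *)

Section time.
Context (R : realType).
Notation mu := (@lebesgue_measure R).
Notation RM := (measurableTypeR R).

Lemma cvg_Rintegral_mul0 (D : set RM) (F : set_system R) {FF : Filter F}
    (w : R -> R) (e : R -> R -> R) : measurable D -> sqintegrable mu D w ->
  (\forall s \near F, sqintegrable mu D (e s)) ->
  \int[mu]_(x in D) e s x ^+ 2 @[s --> F] --> (0 : R) ->
  \int[mu]_(x in D) (w x * e s x) @[s --> F] --> (0 : R).
Proof.
move=> mD hw he e0.
have e1 : Num.sqrt (\int[mu]_(x in D) e s x ^+ 2) @[s --> F] --> (0 : R).
  rewrite -[X in _ --> X](@sqrtr0 R).
  by apply: (cvg_comp _ _ e0); exact: sqrt_continuous.
apply/cvgrPdist_le => eps eps0.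
have e3 : Num.sqrt (\int[mu]_(x in D) w x ^+ 2)
    * Num.sqrt (\int[mu]_(x in D) e s x ^+ 2) @[s --> F] --> (0 : R).
  by rewrite -[X in _ --> X](mulr0 (Num.sqrt (\int[mu]_(x in D) w x ^+ 2)));
    apply: cvgM => //; exact: cvg_cst.
move/cvgrPdist_le : e3 => /(_ _ eps0); apply: filterS2 he => s hs.
rewrite !sub0r !normrN; apply: le_trans; apply: le_trans (ler_norm _).
rewrite -sqrtrM; last by apply: Rintegral_ge0 => x _; exact: sqr_ge0.
by rewrite -sqrtr_sqr ler_sqrt ?Cauchy_Schwarz_Rintegral// mulr_ge0//;
  apply: Rintegral_ge0 => x _; exact: sqr_ge0.
Qed.

(** Write v s = v t + (s - t) (vt + e s), where e s tends to 0 in L^2, and expand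
    the square. *)
Lemma energy_derivative (D : set RM) (v : R -> R -> R) (vt : R -> R) t :
  measurable D -> 0 <= t ->
  (forall s, 0 <= s -> sqintegrable mu D (v s)) -> sqintegrable mu D vt ->
  \int[mu]_(x in D) ((s - t)^-1 * (v s x - v t x) - vt x) ^+ 2
    @[s --> within `[0, +oo[ (dnbhs t)] --> (0 : R) ->
  (s - t)^-1 * (\int[mu]_(x in D) v s x ^+ 2 - \int[mu]_(x in D) v t x ^+ 2)
    @[s --> within `[0, +oo[ (dnbhs t)] --> 2 * \int[mu]_(x in D) (v t x * vt x).
Proof.
move=> mD t0 hv hvt e0; set F := within _ _.
have FF : Filter F by exact: within_filter.
pose e s x := (s - t)^-1 * (v s x - v t x) - vt x.
have Fs : \forall s \near F, 0 <= s /\ s != t.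
  rewrite /F near_withinE; near=> s => /=.
  rewrite in_itv/= andbT => s0; split => //.
  by near: s; exact: nbhs_dnbhs_neq.
have he0 s : 0 <= s -> sqintegrable mu D (e s).
  move=> s0; apply: sqintegrableB => //; apply: sqintegrableZ => //.
  by apply: sqintegrableB => //; exact: hv.
have he : \forall s \near F, sqintegrable mu D (e s).
  by apply: filterS Fs => s [s0 _]; exact: he0.
have X := cvg_Rintegral_mul0 mD (hv _ t0) he e0.
have Y := cvg_Rintegral_mul0 mD hvt he e0.
have st : (s - t) @[s --> F] --> (0 : R).
  rewrite -(subrr t); apply: cvgB; last exact: cvg_cst.
  have Ft : F `=>` nbhs t.
    by move=> A /nbhs_dnbhs At; rewrite /F /within/=; apply: filterS At.
  exact: Ft.
pose B := \int[mu]_(x in D) vt x ^+ 2.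
have lim : 2 * (\int[mu]_(x in D) (v t x * vt x)
                + \int[mu]_(x in D) (v t x * e s x))
    + (s - t) * (B + 2 * \int[mu]_(x in D) (vt x * e s x)
                   + \int[mu]_(x in D) e s x ^+ 2)
    @[s --> F] --> 2 * (\int[mu]_(x in D) (v t x * vt x) + 0)
      + 0 * (B + 2 * 0 + 0).
  apply: cvgD.
    apply: cvgM; first exact: cvg_cst.
    by apply: cvgD; [exact: cvg_cst|exact: X].
  apply: cvgM; first exact: st.
  apply: cvgD; last exact: e0.
  apply: cvgD; first exact: cvg_cst.
  by apply: cvgM; [exact: cvg_cst|exact: Y].
move: lim; rewrite mul0r !addr0; apply: cvg_trans; apply: near_eq_cvg.
apply: filterS Fs => s [s0 st0].
have hs := he0 _ s0; have hts := hv _ t0.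
have hvte := sqintegrableD mD hvt hs.
have -> : \int[mu]_(x in D) v s x ^+ 2 =
    \int[mu]_(x in D) (v t x + (s - t) * (vt x + e s x)) ^+ 2.
  apply: eq_Rintegral => x _; congr (_ ^+ 2); rewrite /e; field.
  by rewrite subr_eq0.
rewrite Rintegral_sqrD//; last exact: sqintegrableZ.
have -> : \int[mu]_(x in D) (v t x * ((s - t) * (vt x + e s x))) =
    (s - t) * (\int[mu]_(x in D) (v t x * vt x)
               + \int[mu]_(x in D) (v t x * e s x)).
  rewrite -RintegralD//; [|exact: sqintegrable_mul|exact: sqintegrable_mul].
  rewrite -RintegralZl//; last first.
    by apply: RintegrableD => //; exact: sqintegrable_mul.
  by apply: eq_Rintegral => x _; ring.
have -> : \int[mu]_(x in D) ((s - t) * (vt x + e s x)) ^+ 2 =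
    (s - t) ^+ 2 * (B + 2 * \int[mu]_(x in D) (vt x * e s x)
                   + \int[mu]_(x in D) e s x ^+ 2).
  rewrite -Rintegral_sqrD// -RintegralZl//; last exact: hvte.2.
  by apply: eq_Rintegral => x _; ring.
by field; rewrite subr_eq0.
Unshelve. all: by end_near. Qed.

(** The function expR (- c * t) * E t has a nonpositive derivative on ]0, oo[; its
    right continuity at 0 comes from the one-sided difference quotients there. *)
Lemma gronwall (E dE : R -> R) (c : R) :
  (forall t, 0 <= t ->
    (s - t)^-1 * (E s - E t) @[s --> within `[0, +oo[ (dnbhs t)] --> dE t) ->
  (forall t, 0 < t -> dE t <= c * E t) ->
  forall t, 0 <= t -> E t <= expR (c * t) * E 0.
Proof.
move=> hE hd t; rewrite le_eqVlt => /predU1P[<-|t0].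
  by rewrite mulr0 expR0 mul1r.
have DE (s : R) : 0 < s -> is_derive s (1 : R) E (dE s).
  move=> s0; have H :
      h^-1 *: ((E \o shift s) (h *: (1 : R)) - E s) @[h --> 0^'] --> dE s.
    apply/cvgrPdist_le => eps eps0.
    have /cvgrPdist_le/(_ _ eps0) := hE _ (ltW s0).
    rewrite near_withinE => -[d /= d0 dP].
    near=> h.
    have h0 : h != 0 by near: h; exact: nbhs_dnbhs_neq.
    have hd' : `|h| < d by near: h; exact: dnbhs0_lt.
    have hs : `|h| < s by near: h; exact: dnbhs0_lt.
    rewrite /= [_ *: 1]mulr1 -[_ *: _]/(_ * _).
    have := dP (h + s); rewrite /= opprD addrCA subrr addr0 normrN addrK => H.
    apply: H => //; first by rewrite -subr_eq0 addrK.
    by rewrite in_itv/= andbT; move: hs; rewrite ltr_norml => /andP[]; lra.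
  apply: DeriveDef; last exact: cvg_lim.
  by apply/cvg_ex; exists (dE s).
pose z (s : R) : R := expR (- c * s) * E s.
have Dz (s : R) : 0 < s ->
    is_derive s (1 : R) z (expR (- c * s) * (dE s - c * E s)).
  move=> s0; have dE' := DE _ s0.
  have dl : is_derive s (1 : R) (fun s => - c * s) (- c).
    apply/is_derive1_caratheodory; exists (fun=> - c); split => //.
      by move=> y; ring.
    exact: cvg_cst.
  have de : is_derive s (1 : R) (expR \o (fun s => - c * s)) (expR (- c * s) * - c).
    exact: is_derive1_comp.
  have -> : z = (expR \o (fun s => - c * s)) * E by apply/funext.
  apply: is_derive_eq; rewrite /= /GRing.scale/=; ring.
have cz (s : R) : 0 < s -> {for s, continuous z}.
  move=> s0; have := @ex_derive _ _ _ _ _ _ _ (Dz s s0).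
  by move=> /derivable1_diffP dx; exact: differentiable_continuous.
have z0 : z s @[s --> 0^'+] --> z 0.
  apply: cvgM.
    apply: cvg_at_right_filter.
    apply: (@continuous_comp _ _ _ (fun s : R => - c * s) expR).
      by apply: mulrl_continuous.
    exact: continuous_expR.
  have q0 : (s - 0)^-1 * (E s - E 0) @[s --> 0^'+] --> dE 0.
    apply: cvg_trans (hE 0 (lexx 0)); apply: cvg_app.
    move=> A; rewrite /within/= => -[d /= d0 dP]; exists d => //= y yd y0.
    by apply: dP => //; rewrite ?gt_eqF//= in_itv/= andbT ltW.
  have : E 0 + s * ((s - 0)^-1 * (E s - E 0)) @[s --> 0^'+] --> E 0 + 0 * dE 0.
    apply: cvgD; first exact: cvg_cst.
    apply: cvgM; last exact: q0.
    exact: (@cvg_at_right_filter _ _ id).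
  rewrite mul0r addr0; apply: cvg_trans; apply: near_eq_cvg.
  near=> s; have s0 : s != 0 by rewrite gt_eqF.
  by rewrite subr0; field.
have zt := @ler0_derive1_le_cc _ z 0 t.
have : z t <= z 0.
  apply: zt => //.
  - move=> x; rewrite in_itv/= => /andP[x0 _].
    exact: (@ex_derive _ _ _ _ _ _ _ (Dz x x0)).
  - move=> x; rewrite in_itv/= => /andP[x0 _].
    rewrite derive1E (@derive_val _ _ _ _ _ _ _ (Dz x x0)).
    by rewrite mulr_ge0_le0 ?expR_ge0// subr_le0 hd.
  - apply/continuous_within_itvP => //; split => //.
      by move=> x; rewrite in_itv/= => /andP[x0 _]; exact: cz.
    by apply: cvg_at_left_filter; exact: cz.
  - by rewrite in_itv/= lexx ltW.
  - by rewrite in_itv/= lexx ltW.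
  - exact: ltW.
rewrite /z mulr0 expR0 mul1r mulNr expRN.
by rewrite ler_pdivrMl ?expR_gt0.
Unshelve. all: by end_near. Qed.

End time.

(** * Real and imaginary parts *)

Section complex_functions.
Context (R : realType).
Notation mu := (@lebesgue_measure R).
Notation RM := (measurableTypeR R).
Variable L : R.
Notation D := (`]0, L[%classic : set RM).
Notation Re := (@complex.Re R).
Notation Im := (@complex.Im R).
Implicit Types (f g : R -> R[i]).

Let mD : measurable D. Proof. exact: measurable_itv. Qed.

Lemma Re_mulc (z w : R[i]) : Re (z * w) = Re z * Re w - Im z * Im w.
Proof. by case: z; case: w. Qed.

Lemma Im_mulc (z w : R[i]) : Im (z * w) = Re z * Im w + Im z * Re w.
Proof. by case: z; case: w. Qed.

Lemma Re_addc (z w : R[i]) : Re (z + w) = Re z + Re w.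
Proof. by case: z; case: w. Qed.

Lemma Im_addc (z w : R[i]) : Im (z + w) = Im z + Im w.
Proof. by case: z; case: w. Qed.

Lemma Re_oppc (z : R[i]) : Re (- z) = - Re z.
Proof. by case: z. Qed.

Lemma Im_oppc (z : R[i]) : Im (- z) = - Im z.
Proof. by case: z. Qed.

Lemma cabs_sqr (z : R[i]) : cabs z ^+ 2 = Re z ^+ 2 + Im z ^+ 2.
Proof. by rewrite /cabs normc_def /= sqr_sqrtr// addr_ge0// sqr_ge0. Qed.

Lemma L2_sqintegrable f : L2 L f ->
  sqintegrable mu D (Re \o f) /\ sqintegrable mu D (Im \o f).
Proof.
move=> [mre mim intf]; split; split => //.
- apply: Rintegrable_le intf => //; first exact: measurable_funX.
  by move=> x _; rewrite cabs_sqr ger0_norm ?sqr_ge0// lerDl sqr_ge0.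
- apply: Rintegrable_le intf => //; first exact: measurable_funX.
  by move=> x _; rewrite cabs_sqr ger0_norm ?sqr_ge0// lerDr sqr_ge0.
Qed.

Lemma L2norm_sqr f : sqintegrable mu D (Re \o f) -> sqintegrable mu D (Im \o f) ->
  L2norm L f ^+ 2
  = \int[mu]_(x in D) Re (f x) ^+ 2 + \int[mu]_(x in D) Im (f x) ^+ 2.
Proof.
move=> hre him; rewrite /L2norm sqr_sqrtr; last first.
  by apply: Rintegral_ge0 => x _; exact: sqr_ge0.
under eq_Rintegral do rewrite cabs_sqr.
by rewrite RintegralD//; [exact: hre.2|exact: him.2].
Qed.

Lemma weak_derivative_Re_Im f g : weak_derivative L f g ->
  (exists k, {ae mu, forall x, D x ->
     Re (f x) = k + primitive ((Re \o g) \_ D) x}) /\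
  (exists k, {ae mu, forall x, D x ->
     Im (f x) = k + primitive ((Im \o g) \_ D) x}).
Proof.
move=> [hf hg fg].
have fin : (mu D < +oo)%E.
  by rewrite [X in (X < _)%E]lebesgue_measure_itv/=; case: ifP; rewrite ?ltry.
have [[rf imf] [rg img]] := (L2_sqintegrable hf, L2_sqintegrable hg).
have E (w : R -> R[i]) (phi : R -> R) :
   (fun x => Re (w x * (phi x)%:C)) = (fun x => (Re \o w) x * phi x) /\
   (fun x => Im (w x * (phi x)%:C)) = (fun x => (Im \o w) x * phi x).
  by split; apply/funext => x; rewrite ?Re_mulc ?Im_mulc /= mulr0 ?subr0 ?add0r.
split; apply: weak_derivative_primitive; try exact: sqintegrable_Rintegrable.
- move=> phi /fg; rewrite /cintegral => -[+ _].
  by rewrite (E f _).1 (E g _).1.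
- move=> phi /fg; rewrite /cintegral => -[_].
  by rewrite (E f _).2 (E g _).2.
Qed.

Lemma boundary_values0_Re_Im g : boundary_values L g 0 0 ->
  (exists c, [/\ {within `[0, L], continuous c},
      {ae mu, forall x, D x -> Re (g x) = c x}, c 0 = 0 & c L = 0]) /\
  (exists c, [/\ {within `[0, L], continuous c},
      {ae mu, forall x, D x -> Im (g x) = c x}, c 0 = 0 & c L = 0]).
Proof.
move=> [c [cr ci gc c0 cL]]; split.
- exists (Re \o c); rewrite /= c0 cL; split => //.
  by apply: (@filterS _ _ (ae_filter_ringOfSetsType mu)) gc => x + Dx;
    move=> /(_ Dx) ->.
- exists (Im \o c); rewrite /= c0 cL; split => //.
  by apply: (@filterS _ _ (ae_filter_ringOfSetsType mu)) gc => x + Dx;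
    move=> /(_ Dx) ->.
Qed.

Lemma average_sum N f x :
  Re (\sum_(1 <= k < N.+1) average (J L N k) f * (\1_(J L N k) x)%:C)
    = cell_averages L N (Re \o f) x /\
  Im (\sum_(1 <= k < N.+1) average (J L N k) f * (\1_(J L N k) x)%:C)
    = cell_averages L N (Im \o f) x.
Proof.
rewrite /cell_averages; elim: (index_iota _ _) => [|k s [IHr IHi]].
  by rewrite !big_nil.
rewrite !big_cons Re_addc Im_addc IHr IHi /average /cintegral; split.
  by rewrite !(Re_mulc, Im_mulc) /= !(mulr0, mul0r, subr0, addr0).
by rewrite !(Re_mulc, Im_mulc) /= !(mulr0, mul0r, subr0, addr0, add0r).
Qed.

End complex_functions.

(** * The decay estimate *)

Section energy.
Context (R : realType).
Notation mu := (@lebesgue_measure R).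
Notation RM := (measurableTypeR R).
Notation Re := (@complex.Re R).
Notation Im := (@complex.Im R).
Variable L : R.
Notation D := (`]0, L[%classic : set RM).

Lemma neumann_by_parts (g g1 f f1 : R -> R) (c : R -> R) (k l : R) :
  0 < L ->
  sqintegrable mu D g -> sqintegrable mu D g1 ->
  sqintegrable mu D f -> sqintegrable mu D f1 ->
  {ae mu, forall x, D x -> g x = k + primitive (g1 \_ D) x} ->
  {ae mu, forall x, D x -> f x = l + primitive (f1 \_ D) x} ->
  {within `[0, L], continuous c} -> {ae mu, forall x, D x -> g x = c x} ->
  c 0 = 0 -> c L = 0 ->
  \int[mu]_(x in D) (g1 x * f x) = - \int[mu]_(x in D) (g x * f1 x).
Proof.
move=> L0 hg hg1 hf hf1 gk fl cc gc c0 cL.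
have mD : measurable D by exact: measurable_itv.
have int1 : mu.-integrable D (EFin \o g1).
  apply: sqintegrable_Rintegrable => //.
  by rewrite [X in (X < _)%E]lebesgue_measure_itvoo// ltry.
have [gP g10] := neumann_primitive L0 int1 gk cc gc c0 cL.
exact: primitive_integration_by_parts fl gP g10.
Qed.

(** Multiply the equation by the conjugate of u and take real parts.  The term in
    beta cancels pointwise.  The term in kappa is nonnegative and is dropped
    pointwise, before integrating: the integrability of |u|^(p + 2) does not come
    up.  After integration by parts the term in lambda becomes - lambda \int |ux|^2
    and the term in alpha vanishes, being the imaginary part of a real number. *)
Lemma energy_inequality (p lambda kappa gamma alpha beta nu : R) (N : nat)
    (u ux uxx ut : R -> R[i]) :
  0 < L -> 0 < kappa -> 0 <= nu -> (0 < N)%N ->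
  nu * (L / N%:R) ^+ 2 / 4 <= lambda ->
  weak_derivative L u ux -> weak_derivative L ux uxx -> L2 L ut ->
  boundary_values L ux 0 0 ->
  {ae mu, forall x, x \in `]0, L[ ->
     ut x - (lambda +i* alpha) * uxx x
       + (kappa +i* beta) * (cabs (u x) `^ p)%:C * u x - gamma%:C * u x
     = - nu%:C * \sum_(1 <= k < N.+1)
                   average (J L N k) u * (\1_(J L N k) x)%:C} ->
  \int[mu]_(x in D) (Re (u x) * Re (ut x))
    + \int[mu]_(x in D) (Im (u x) * Im (ut x))
  <= (gamma - nu / 4) * L2norm L u ^+ 2.
Proof.
move=> L0 kappa0 nu0 N0 nul wu wux hut bux eqn.
have mD : measurable D by exact: measurable_itv.
have fin : (mu D < +oo)%E.
  by rewrite [X in (X < _)%E]lebesgue_measure_itvoo// ltry.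
have [[l1 uaP] [l2 ubP]] := weak_derivative_Re_Im wu.
have [[k1 axP] [k2 bxP]] := weak_derivative_Re_Im wux.
have [[c1 [cc1 axc c10 c1L]] [c2 [cc2 bxc c20 c2L]]] := boundary_values0_Re_Im bux.
case: wu => /L2_sqintegrable[ha hb] _ _.
case: wux => /L2_sqintegrable[hax hbx] /L2_sqintegrable[haxx hbxx] _.
have {hut}[hat hbt] := L2_sqintegrable hut.
pose a := Re \o u; pose b := Im \o u; pose ax := Re \o ux; pose bx := Im \o ux.
pose axx := Re \o uxx; pose bxx := Im \o uxx; pose at_ := Re \o ut.
pose bt := Im \o ut.
have P1 := neumann_by_parts L0 hax haxx ha hax axP uaP cc1 axc c10 c1L.
have P2 := neumann_by_parts L0 hax haxx hb hbx axP ubP cc1 axc c10 c1L.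
have P3 := neumann_by_parts L0 hbx hbxx ha hax bxP uaP cc2 bxc c20 c2L.
have P4 := neumann_by_parts L0 hbx hbxx hb hbx bxP ubP cc2 bxc c20 c2L.
have C1 := cell_coercivity L0 N0 nu0 nul ha hax uaP.
have C2 := cell_coercivity L0 N0 nu0 nul hb hbx ubP.
pose A := cell_averages L N a; pose B := cell_averages L N b.
have iA : mu.-integrable D (EFin \o (fun x => a x * A x)).
  by apply: Rintegrable_cell_averages => //; exact: sqintegrable_Rintegrable.
have iB : mu.-integrable D (EFin \o (fun x => b x * B x)).
  by apply: Rintegrable_cell_averages => //; exact: sqintegrable_Rintegrable.
pose rhs x := lambda * (axx x * a x + bxx x * b x)
  + alpha * (axx x * b x - bxx x * a x) + gamma * (a x ^+ 2 + b x ^+ 2)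
  - nu * (a x * A x + b x * B x).
have i1 := sqintegrable_mul mD haxx ha; have i2 := sqintegrable_mul mD hbxx hb.
have i3 := sqintegrable_mul mD haxx hb; have i4 := sqintegrable_mul mD hbxx ha.
have i5 := sqintegrable_mul mD ha hat; have i6 := sqintegrable_mul mD hb hbt.
have irhs1 := RintegrableZ mD lambda (RintegrableD mD i1 i2).
have irhs2 := RintegrableZ mD alpha (RintegrableB mD i3 i4).
have irhs3 := RintegrableZ mD gamma (RintegrableD mD ha.2 hb.2).
have irhs4 := RintegrableZ mD nu (RintegrableD mD iA iB).
have i12 := RintegrableD mD irhs1 irhs2.
have i123 := RintegrableD mD i12 irhs3.
have : \int[mu]_(x in D) (a x * at_ x + b x * bt x) <= \int[mu]_(x in D) rhs x.
  apply: ae_le_Rintegral => //; [exact: RintegrableD|exact: RintegrableB|].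
  apply: (@filterS _ _ (ae_filter_ringOfSetsType mu)) eqn => x + Dx.
  move=> /(_ Dx) eqx.
  have [avr avi] := average_sum L N u x.
  have := congr1 Re eqx; have := congr1 Im eqx.
  rewrite !(Re_addc, Im_addc, Re_oppc, Im_oppc, Re_mulc, Im_mulc) avr avi /=.
  rewrite -/(a x) -/(b x) -/(axx x) -/(bxx x) -/(at_ x) -/(bt x) -/(A x) -/(B x).
  rewrite /rhs; set m := _ `^ p => Ei Er.
  have m0 : 0 <= m by exact: powR_ge0.
  have Kp : 0 <= kappa * m * (a x ^+ 2 + b x ^+ 2).
    by rewrite mulr_ge0 ?addr_ge0 ?sqr_ge0// mulr_ge0// ltW.
  have -> : at_ x = lambda * axx x - alpha * bxx x - kappa * m * a x
      + beta * m * b x + gamma * a x - nu * A x.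
    by clear - Er; lra.
  have -> : bt x = lambda * bxx x + alpha * axx x - kappa * m * b x
      - beta * m * a x + gamma * b x - nu * B x.
    by clear - Ei; lra.
  rewrite -subr_ge0.
  by rewrite (_ : _ - _ = kappa * m * (a x ^+ 2 + b x ^+ 2))//; ring.
rewrite RintegralD// /rhs RintegralB// RintegralD// RintegralD//.
rewrite RintegralZl//; last exact: RintegrableD.
rewrite RintegralZl//; last exact: RintegrableB.
rewrite RintegralZl//; last exact: (RintegrableD mD ha.2 hb.2).
rewrite RintegralZl//; last exact: RintegrableD.
rewrite RintegralD// RintegralB// RintegralD//; [|exact: ha.2|exact: hb.2].
rewrite RintegralD//.
(* P2 and P3 give the same integral of ax * bx, which cancels the alpha term. *)
rewrite {}P1 {}P2 {}P3 {}P4.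
have sq (w : R -> R) : \int[mu]_(x in D) (w x * w x) = \int[mu]_(x in D) w x ^+ 2.
  by apply: eq_Rintegral => x _; rewrite expr2.
have comm : \int[mu]_(x in D) (bx x * ax x) = \int[mu]_(x in D) (ax x * bx x).
  by apply: eq_Rintegral => x _; rewrite mulrC.
rewrite !sq -/ax -/bx comm => H; apply: (le_trans H); move: C1 C2.
rewrite -/a -/b -/ax -/bx -/A -/B.
rewrite (L2norm_sqr ha hb).
rewrite -[\int[mu]_(x in D) Re (u x) ^+ 2]/(\int[mu]_(x in D) a x ^+ 2).
rewrite -[\int[mu]_(x in D) Im (u x) ^+ 2]/(\int[mu]_(x in D) b x ^+ 2).
by clear; lra.
Qed.

(** The real and imaginary parts of the difference quotients converge in L^2,
    being dominated by the complex ones. *)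
Lemma L2norm_sqr_derivative (u ut : R -> R -> R[i]) : C1_L2 L u ut ->
  forall t, 0 <= t ->
  (s - t)^-1 * (L2norm L (u s) ^+ 2 - L2norm L (u t) ^+ 2)
    @[s --> within `[0, +oo[ (dnbhs t)] -->
  2 * (\int[mu]_(x in D) (Re (u t x) * Re (ut t x))
       + \int[mu]_(x in D) (Im (u t x) * Im (ut t x))).
Proof.
move=> [uL2 ut_lim _] t t0; have mD : measurable D by exact: measurable_itv.
have [/L2_sqintegrable[hut1 hut2] /L2_sqintegrable[hutt1 hutt2]] := uL2 _ t0.
set F := within _ _; have FF : Filter F by exact: within_filter.
pose e s x := ((s - t)^-1)%:C * (u s x - u t x) - ut t x.
have ReE s x : Re (e s x) =
    (s - t)^-1 * (Re (u s x) - Re (u t x)) - Re (ut t x).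
  by rewrite /e !(Re_addc, Re_oppc, Re_mulc) /= mul0r subr0.
have ImE s x : Im (e s x) =
    (s - t)^-1 * (Im (u s x) - Im (u t x)) - Im (ut t x).
  by rewrite /e !(Im_addc, Im_oppc, Im_mulc) /= mul0r addr0.
have lim := ut_lim _ t0.
have lim2 : L2norm L (e s) ^+ 2 @[s --> F] --> (0 : R).
  rewrite -(mulr0 (0 : R)); under eq_fun do rewrite expr2.
  exact: cvgM.
have Fs : \forall s \near F, L2norm L (e s) ^+ 2
    = \int[mu]_(x in D) Re (e s x) ^+ 2
      + \int[mu]_(x in D) Im (e s x) ^+ 2.
  rewrite /F near_withinE; apply: nearW => s; rewrite /= in_itv/= andbT => s0.
  have [/L2_sqintegrable[? ?] _] := uL2 _ s0.
  rewrite L2norm_sqr//.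
    rewrite (_ : _ \o _ = (fun x => (s - t)^-1 *
      (Re (u s x) - Re (u t x)) - Re (ut t x))).
      apply: sqintegrableB => //; apply: sqintegrableZ => //.
      exact: sqintegrableB.
    by apply/funext => x /=; rewrite ReE.
  rewrite (_ : _ \o _ = (fun x => (s - t)^-1 *
      (Im (u s x) - Im (u t x)) - Im (ut t x))).
    apply: sqintegrableB => //; apply: sqintegrableZ => //.
    exact: sqintegrableB.
  by apply/funext => x /=; rewrite ImE.
have limRe : \int[mu]_(x in D) Re (e s x) ^+ 2
    @[s --> F] --> (0 : R).
  apply: (squeeze_cvgr _ (cvg_cst 0) lim2).
  apply: filterS Fs => s ->; rewrite lerDl !Rintegral_ge0//= => x _; exact: sqr_ge0.
have limIm : \int[mu]_(x in D) Im (e s x) ^+ 2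
    @[s --> F] --> (0 : R).
  apply: (squeeze_cvgr _ (cvg_cst 0) lim2).
  apply: filterS Fs => s ->; rewrite lerDr !Rintegral_ge0//= => x _; exact: sqr_ge0.
have dRe := @energy_derivative _ D (fun s x => Re (u s x)) _ t mD t0
  (fun s s0 => (L2_sqintegrable (uL2 s s0).1).1) hutt1.
have dIm := @energy_derivative _ D (fun s x => Im (u s x)) _ t mD t0
  (fun s s0 => (L2_sqintegrable (uL2 s s0).1).2) hutt2.
rewrite mulrDr.
have : (s - t)^-1 * (\int[mu]_(x in D) Re (u s x) ^+ 2
                   - \int[mu]_(x in D) Re (u t x) ^+ 2)
   + (s - t)^-1 * (\int[mu]_(x in D) Im (u s x) ^+ 2
                   - \int[mu]_(x in D) Im (u t x) ^+ 2)
   @[s --> F] -->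
   2 * \int[mu]_(x in D) (Re (u t x) * Re (ut t x))
   + 2 * \int[mu]_(x in D) (Im (u t x) * Im (ut t x)).
  apply: cvgD.
    apply: dRe; apply: cvg_trans limRe; apply: near_eq_cvg; apply: nearW => s.
    by apply: eq_Rintegral => x _; rewrite ReE.
  apply: dIm; apply: cvg_trans limIm; apply: near_eq_cvg; apply: nearW => s.
  by apply: eq_Rintegral => x _; rewrite ImE.
apply: cvg_trans; apply: near_eq_cvg.
rewrite /F near_withinE; apply: nearW => s; rewrite /= in_itv/= andbT => s0.
have [/L2_sqintegrable[hus1 hus2] _] := uL2 _ s0.
by rewrite (L2norm_sqr hus1 hus2) (L2norm_sqr hut1 hut2); ring.
Qed.

End energy.

Theorem theorem2p1 (R : realType) (L p lambda kappa gamma alpha beta mu : R)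
    (N : nat) (u ux uxx ut : R -> R -> R[i]) (u0 : R -> R[i])
    (L_gt0 : 0 < L) (p_gt0 : 0 < p) (lambda_gt0 : 0 < lambda)
    (kappa_gt0 : 0 < kappa) (gamma_gt0 : 0 < gamma) (mu_neq0 : mu != 0)
    (N_gt0 : (0 < N)%N)
    (N_large : 1 / N%:R ^+ 2
               < Num.min (1 - 4 * gamma / mu) (4 * lambda / (mu * L ^+ 2)))
    (u_H2 : C_H2 L u ux uxx) (u_L2 : C1_L2 L u ut) (u0_L2 : L2 L u0)
    (u_eq : forall t, 0 < t ->
       {ae lebesgue_measure, forall x, x \in `]0, L[ ->
          ut t x - (lambda +i* alpha) * uxx t x
            + (kappa +i* beta) * (cabs (u t x) `^ p)%:C * u t x
            - gamma%:C * u t x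
          = - mu%:C * \sum_(1 <= k < N.+1)
                        average (J L N k) (u t) * (\1_(J L N k) x)%:C})
    (u_neumann : forall t, 0 < t -> boundary_values L (ux t) 0 0)
    (u_init : {ae lebesgue_measure, forall x, x \in `]0, L[ -> u 0 x = u0 x}) :
  forall t, 0 <= t ->
    L2norm L (u t) ^+ 2
    <= expR (- mu * (1 / 2 - 2 * gamma / mu - 1 / (2 * N%:R ^+ 2)) * t)
       * L2norm L u0 ^+ 2.
Proof.
have N0 : 0 < N%:R :> R by rewrite ltr0n.
have iN0 : 0 < 1 / N%:R ^+ 2 :> R by rewrite divr_gt0// exprn_gt0.
(* The second bound on 1 / N^2 > 0 has the sign of mu. *)
have mu_gt0 : 0 < mu.
  move: N_large; rewrite lt_min => /andP[_ /(lt_trans iN0)].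
  rewrite pmulr_rgt0 ?mulr_gt0// invr_gt0 pmulr_lgt0//.
  by rewrite exprn_gt0.
have cell_small : mu * (L / N%:R) ^+ 2 / 4 <= lambda.
  move: N_large; rewrite lt_min => /andP[_ /ltW].
  rewrite ler_pdivlMr ?mulr_gt0 ?exprn_gt0// => H.
  have -> : mu * (L / N%:R) ^+ 2 / 4 = 1 / N%:R ^+ 2 * (mu * L ^+ 2) / 4.
    by field; rewrite gt_eqF.
  lra.
have init : L2norm L (u 0) ^+ 2 = L2norm L u0 ^+ 2.
  have [/(_ 0 (lexx 0))[[_ _ int_u] _] _ _] := u_L2.
  have [_ _ int_u0] := u0_L2.
  congr (Num.sqrt _ ^+ 2); apply: ae_eq_Rintegral => //.
  apply: (@filterS _ _ (ae_filter_ringOfSetsType lebesgue_measure)) u_init.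
  by move=> x + Dx; move=> /(_ Dx) ->.
have decay :=
  gronwall (L2norm_sqr_derivative u_L2) (c := 2 * (gamma - mu / 4)) _.
move=> t t0; rewrite -init; apply: le_trans (decay _ t t0) _.
  move=> s s0; rewrite -mulrA ler_pM2l//.
  have [/(_ s (ltW s0)) [hu hux] _] := u_H2.
  have [/(_ s (ltW s0)) [_ hut] _ _] := u_L2.
  exact: (energy_inequality L_gt0 kappa_gt0 (ltW mu_gt0) N_gt0 cell_small
    hu hux hut (u_neumann s s0) (u_eq s s0)).
rewrite ler_wpM2r ?sqr_ge0// ler_expR ler_wpM2r//.
(* The rate obtained is better than the stated one by mu / (2 N^2). *)
have -> : - mu * (1 / 2 - 2 * gamma / mu - 1 / (2 * N%:R ^+ 2))
    = 2 * (gamma - mu / 4) + mu * (1 / N%:R ^+ 2) / 2.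
  by field; rewrite mu_neq0 gt_eqF.
by rewrite lerDl divr_ge0// mulr_ge0// ltW.
Qed.
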